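(* Let $V$ be a $\mathbb{Z}^n$-graded vector space, let $\mathrm{Lod}(V)$ be the set of $\mathbb{Z}^n$-graded Loday structures on $V$, and denote by $\mathrm{CoDiff}^Q_p(T(\downarrow V))$, $Q\in\mathbb{Z}^n$, $p\in\mathbb{N}^*$, the set of codifferentials of $(T(\downarrow V),\Delta)$ that have weight $Q$ and whose corestriction maps all vanish except $Q_p$. Then: (1) the restriction of $\phi_{(0,1)}$ to $\mathrm{Lod}(V)$ is a bijection and $\mathrm{Lod}(V)\simeq\mathrm{CoDiff}_2^{e_1}(T(\downarrow V))$; (2) the graded Loday structures on $V$ are exactly the canonical elements of weight $(0,1)$ of the graded Lie algebra $(M_r(V),[-,-]^\otimes)$.
   Context: Vector spaces are over a field $\mathbb{K}$ of characteristic $0$; for $\alpha,\beta\in\mathbb{Z}^m$, $\langle\alpha,\beta\rangle=\sum_i\alpha_i\beta_i$. A homogeneous vector or map and its degree/weight are denoted by the same symbol; $e_1=(1,0,\ldots,0)\in\mathbb{Z}^n$. A homogeneous element $w$ is odd if $\langle w,w\rangle$ is odd; a canonical element of a graded Lie algebra $(L,[-,-])$ is an odd $\pi\in L$ with $[\pi,\pi]=0$. A $\mathbb{Z}^n$-graded Loday structure on $V$ is a weight $0$ bilinear bracket $\{-,-\}$ on $V$ with $\{a,\{b,c\}\}=\{\{a,b\},c\}+(-1)^{\langle a,b\rangle}\{b,\{a,c\}\}$ for homogeneous $a,b,c$. $M^{(A,a)}(V)$, $a\ge0$, is the space of $(a+1)$-linear maps $V^{\times(a+1)}\to V$ of weight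 $A\in\mathbb{Z}^n$, and $M_r(V)=\bigoplus_{A\in\mathbb{Z}^n,\,a\ge0}M^{(A,a)}(V)$, with $M^{(A,a)}(V)$ in degree $(A,a)\in\mathbb{Z}^{n}\times\mathbb{Z}$. Tensor coalgebra. For a graded space $W$, $T(W)=\bigoplus_{p\ge1}W^{\otimes p}$, $\mathbb{Z}^n$-graded by total degree, with coproduct $\Delta(w_1\otimes\ldots\otimes w_p)=\sum_{I\cup J=N^{(p-1)},\,I\ne\emptyset}\varepsilon_W(I;J)W_I\bigotimes W_J\otimes w_p$. Here $N^{(p)}=(1,\ldots,p)$, $I,J$ are disjoint naturally ordered subsets (unshuffles) with the given union, $W_I=w_{i_1}\otimes\ldots\otimes w_{i_{|I|}}$, and $\varepsilon_W(I;J)$ is the Koszul sign of the rearrangement of $(W_I,W_J)$ into increasing index order. Tensor products of maps: $(f\otimes g)(v_1\otimes v_2)=(-1)^{\langle g,v_1\rangle}f(v_1)\otimes g(v_2)$. A weight $Q$ coderivation is a weight $Q$ linear map with $\Delta Q=(Q\otimes\mathrm{id}+\mathrm{id}\otimes Q)\Delta$; a codifferential is a coderivation $Q$ with $Q^2=0$. The graded commutator is $[Q,Q']=QQ'-(-1)^{\langle Q,Q'\rangle}Q'Q$. A weight $Q$ coderivation is uniquely determined by its corestrictions $Q_p:W^{\otimes p}\hookrightarrow T(W)\xrightarrow{Q}T(W)\to W$, which can be arbitrary weight $Q$ maps, via $$Q(w_1\otimes\ldots\otimes w_p)=\sum_{I\cup J\cup K=N^{(p)},\;I,J<K}\varepsilon_W(I;J)(-1)^{\langle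 Q,W_I\rangle}W_I\otimes Q_{|J|+1}(W_J\otimes w_{k_1})\otimes W_{K\setminus k_1},$$ with $I,J$ possibly empty, $K=(k_1<k_2<\ldots)$ nonempty, and $I<K$ meaning that the last element of $I$ is smaller than $k_1$. $\mathrm{CoDer}^Q_p(T(W))$ denotes the weight $Q$ coderivations all of whose corestrictions vanish except possibly $Q_p$. Desuspension. $\downarrow V$ is $V$ with grading $(\downarrow V)^\alpha=V^{\alpha+e_1}$; $\downarrow:V\to\downarrow V$ has weight $-e_1$ and inverse $\uparrow$ of weight $e_1$; $\uparrow^{\otimes p}=\uparrow\otimes\ldots\otimes\uparrow$ with the sign convention $(f\otimes g)(v_1\otimes v_2)=(-1)^{\langle g,v_1\rangle}f(v_1)\otimes g(v_2)$ for tensor products of maps. The isomorphism $\phi_{(A,a)}:M^{(A,a)}(V)\to\mathrm{CoDer}^{A+ae_1}_{a+1}(T(\downarrow V))$ sends $A$ to the coderivation whose only (possibly) nonzero corestriction is $(-1)^{\frac{a(a+1)}{2}}\downarrow\circ A\circ\uparrow^{\otimes(a+1)}$. The stem bracket on $M_r(V)$ is the $\mathbb{Z}^{n+1}$-graded Lie bracket $[A,B]^\otimes:=(-1)^{1+\langle ae_1,be_1+B\rangle}\phi^{-1}_{(A+B,a+b)}([\phi_{(A,a)}(A),\phi_{(B,b)}(B)])$ for $A\in M^{(A,a)}(V)$, $B\in M^{(B,b)}(V)$. *)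

(* Defs.v *)
From HB Require Import structures.
From mathcomp Require Import all_boot all_order all_algebra.
From mathcomp Require Import finmap freeg.
From mathcomp Require Import boolp classical_sets functions.

Set Implicit Arguments.
Unset Strict Implicit.
Unset Printing Implicit Defensive.

Import GRing.Theory.

Local Open Scope classical_set_scope.
Local Open Scope ring_scope.

Inductive in_span (K : fieldType) (V : lmodType K) (R : set V) : set V :=
| in_span0 : in_span R 0
| in_spanD c u v : R u -> in_span R v -> in_span R (c *: u + v).

Section Span.
Variables (K : fieldType) (V : lmodType K) (R : set V).

Lemma span_add u v : in_span R u -> in_span R v -> in_span R (u + v).
Proof.
move=> + hv; elim => [|c x y Rx _ IH]; first by rewrite add0r.
by rewrite -addrA; apply: in_spanD.
Qed.

Lemma span_scale a u : in_span R u -> in_span R (a *: u).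
Proof.
elim => [|c x y Rx _ IH]; first by rewrite scaler0; apply: in_span0.
by rewrite scalerDr scalerA; apply: in_spanD.
Qed.

Lemma span_gen u : R u -> in_span R u.
Proof.
by move=> Ru; rewrite -[u]addr0 -[u]scale1r; apply: in_spanD => //; apply: in_span0.
Qed.

Definition spanp : {pred V} := fun v => `[< in_span R v >].

Lemma spanp_zmod : zmod_closed spanp.
Proof.
split; first by apply/asboolP; apply: in_span0.
move=> u v /asboolP hu /asboolP hv; apply/asboolP; apply: span_add => //.
by rewrite -scaleN1r; apply: span_scale.
Qed.
HB.instance Definition _ := GRing.isZmodClosed.Build V spanp spanp_zmod.

Lemma spanp_scaler : scaler_closed spanp.
Proof. by move=> c u /asboolP hu; apply/asboolP; apply: span_scale. Qed.
HB.instance Definition _ := GRing.isScaleClosed.Build K V spanp spanp_scaler.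

Definition modquot : Type := {ideal_quot spanp}.
HB.instance Definition _ := GRing.Zmodule.on modquot.

Definition qpi (v : V) : modquot := (\pi_{ideal_quot spanp} v)%qT.

Definition qscale (c : K) (x : modquot) : modquot :=
  qpi (c *: repr (x : {ideal_quot spanp})).

Lemma qpi_eq u v : in_span R (u - v) -> qpi u = qpi v.
Proof.
by move=> h; apply/eqP; rewrite /qpi -Quotient.idealrBE; apply/asboolP.
Qed.

Lemma qpi_span u v : qpi u = qpi v -> in_span R (u - v).
Proof.
by move=> /eqP; rewrite /qpi -Quotient.idealrBE => /asboolP.
Qed.

Lemma qpi_repr (x : modquot) : qpi (repr (x : {ideal_quot spanp})) = x.
Proof. exact: reprK. Qed.

Lemma qpiD u v : qpi (u + v) = qpi u + qpi v.
Proof. by rewrite /qpi raddfD. Qed.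

Lemma qpi0 : qpi 0 = 0.
Proof. by rewrite /qpi raddf0. Qed.

Lemma qscale_pi c v : qscale c (qpi v) = qpi (c *: v).
Proof.
apply: qpi_eq; rewrite -scalerBr; apply: span_scale; apply: qpi_span.
exact: qpi_repr.
Qed.

Lemma qscaleA a b x : qscale a (qscale b x) = qscale (a * b) x.
Proof. by rewrite -[x]qpi_repr !qscale_pi scalerA. Qed.
Lemma qscale1 : left_id 1 qscale.
Proof. by move=> x; rewrite -[x]qpi_repr !qscale_pi scale1r. Qed.
Lemma qscaleDr : right_distributive qscale +%R.
Proof.
move=> a x y; rewrite -[x]qpi_repr -[y]qpi_repr.
by rewrite -qpiD !qscale_pi scalerDr qpiD.
Qed.
Lemma qscaleDl x : {morph qscale^~ x : a b / a + b}.
Proof. by move=> a b; rewrite -[x]qpi_repr !qscale_pi scalerDl qpiD. Qed.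

HB.instance Definition _ := GRing.Zmodule_isLmodule.Build K modquot
  qscaleA qscale1 qscaleDr qscaleDl.

Lemma qpiZ c v : qpi (c *: v) = c *: qpi v.
Proof. by rewrite -qscale_pi. Qed.

End Span.

Section Presented.
Variables (K : fieldType) (X : choiceType) (R : set {freeg X / K}).

Definition pres : Type := modquot R.
HB.instance Definition _ := GRing.Lmodule.on pres.

Definition pgen (x : X) : pres := qpi R (<< x >> : {freeg X / K}).

(* When the linear extension of f kills R, [plift f] is the linear map sending
   the generator x to f x (see plift_gen, plift_linear); it is irrelevant
   otherwise.                                                                *)
Definition plift (U : lmodType K) (f : X -> U) (t : pres) : U :=
  fglift f (repr (t : {ideal_quot spanp R})).

Lemma fglift_linear (U : lmodType K) (f : X -> U) c (u v : {freeg X / K}) :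
  fglift f (c *: u + v) = c *: fglift f u + fglift f v.
Proof.
have hA a b : fglift f (a + b) = fglift f a + fglift f b.
  have h := lift_is_additive f.
  have h0 : fglift f 0 = 0 by rewrite -[0 in LHS](subrr 0) h subrr.
  have hN x : fglift f (- x) = - fglift f x by rewrite -[- x]add0r h h0 sub0r.
  by rewrite -{1}[b]opprK h hN opprK.
rewrite hA; congr (_ + _).
have h0 : fglift f 0 = 0.
  by apply: (@addrI _ (fglift f 0)); rewrite -hA !addr0.
have key r : fglift f (\sum_(x <- r) << c * coeff x u *g x >>) =
             c *: fglift f (\sum_(x <- r) << coeff x u *g x >>).
  elim: r => [|x r IH]; first by rewrite !big_nil h0 scaler0.
  by rewrite !big_cons !hA IH scalerDr !liftU scalerA.
by have := key (dom u); rewrite freeg_sumE.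
Qed.

Lemma plift_pi (U : lmodType K) (f : X -> U) (v : {freeg X / K}) :
  (forall r, R r -> fglift f r = 0) -> plift f (qpi R v) = fglift f v.
Proof.
move=> hR.
have hspan w : in_span R w -> fglift f w = 0.
  have h0 : fglift f 0 = 0.
    have := fglift_linear f 1 0 0; rewrite scale1r addr0 scale1r => /eqP.
    by rewrite -subr_eq0 opprD addrA subrr sub0r oppr_eq0 => /eqP.
  elim=> // c a b Ra _ IH.
  by rewrite fglift_linear hR // IH scaler0 addr0.
rewrite /plift; set w := repr _.
have /qpi_span/hspan h : qpi R w = qpi R v by rewrite qpi_repr.
have := fglift_linear f 1 (w - v) v.
by rewrite !scale1r subrK h add0r.
Qed.

Lemma plift_gen (U : lmodType K) (f : X -> U) x :
  (forall r, R r -> fglift f r = 0) -> plift f (pgen x) = f x.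
Proof. by move=> hR; rewrite plift_pi // liftU scale1r. Qed.

Lemma plift_linear (U : lmodType K) (f : X -> U) :
  (forall r, R r -> fglift f r = 0) -> linear (plift f).
Proof.
move=> hR c x y; rewrite -[x]qpi_repr -[y]qpi_repr -qpiZ -qpiD.
by rewrite !plift_pi // fglift_linear.
Qed.

Lemma pres_ind (P : pres -> Prop) : P 0 ->
  (forall c x t, P t -> P (c *: pgen x + t)) -> forall t, P t.
Proof.
move=> P0 PD t; rewrite -[t]qpi_repr; set u := repr _.
rewrite -(freeg_sumE u); elim: (dom u) => [|x s IH].
  by rewrite big_nil qpi0.
rewrite big_cons qpiD.
suff -> : qpi R << coeff x u *g x >> = coeff x u *: pgen x by apply: PD.
rewrite /pgen -qpiZ; congr qpi; apply/eqP/freeg_eqP => y.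
by rewrite [RHS]coeff_fgscale !coeffU mul1r.
Qed.

End Presented.

Lemma linear_0 (K : fieldType) (U V : lmodType K) (f : U -> V) : linear f -> f 0 = 0.
Proof.
move=> hf; have := hf 1 0 0; rewrite !scale1r addr0 => /esym/eqP.
by rewrite -subr_eq0 addrK => /eqP.
Qed.

Section Graded.
Variables (K : fieldType) (n : nat).

Definition is_homdec (V : lmodType K) (comp : 'rV[int]_n -> set V)
    (v : V) (f : {fsfun 'rV[int]_n -> V with 0}) :=
  (forall a, comp a (f a)) /\ v = \sum_(a <- finsupp f) f a.

(* A Z^n-graded vector space: an (internal) direct sum of the subspaces
   [gcomp a], i.e. every vector is in exactly one way a finite sum of
   homogeneous vectors of distinct degrees.                                  *)
Record gradedSpace := GradedSpace {
  gcarrier :> lmodType K;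
  gcomp : 'rV[int]_n -> set gcarrier;
  gcomp_sub : forall a, gcomp a 0 /\
    forall c x y, gcomp a x -> gcomp a y -> gcomp a (c *: x + y);
  gcomp_dec : forall v, exists! f, is_homdec gcomp v f }.

Definition dot (a b : 'rV[int]_n) : int := \sum_i a ord0 i * b ord0 i.

Definition sgn (z : int) : K := (-1) ^ z.

Definition has_weight (U V : gradedSpace) (Q : 'rV[int]_n) (f : U -> V) :=
  forall a u, gcomp a u -> gcomp (a + Q) (f u).

Section Components.
Variable V : gradedSpace.

Lemma dec_ex (v : V) : exists f, is_homdec (@gcomp V) v f.
Proof. by have [f [hf _]] := gcomp_dec v; exists f. Qed.

Definition dec (v : V) : {fsfun 'rV[int]_n -> V with 0} := sval (cid (dec_ex v)).

Lemma decP v : is_homdec (@gcomp V) v (dec v).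
Proof. exact: svalP (cid (dec_ex v)). Qed.

Lemma dec_uniq v f : is_homdec (@gcomp V) v f -> dec v = f.
Proof. by have [g [_ hg]] := gcomp_dec v => hf; rewrite -(hg _ hf) (hg _ (decP v)). Qed.

Lemma gcomp0 a : gcomp a (0 : V).
Proof. by have [] := gcomp_sub V a. Qed.

Lemma gcompL a c (x y : V) : gcomp a x -> gcomp a y -> gcomp a (c *: x + y).
Proof. by have [_] := gcomp_sub V a; apply. Qed.

Lemma gcompD a (x y : V) : gcomp a x -> gcomp a y -> gcomp a (x + y).
Proof. by move=> hx hy; rewrite -[x]scale1r; apply: gcompL. Qed.

Lemma gcompZ a c (x : V) : gcomp a x -> gcomp a (c *: x).
Proof. by move=> hx; rewrite -[_ *: _]addr0; apply: gcompL => //; apply: gcomp0. Qed.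

Lemma dec_sum v (A : {fset 'rV[int]_n}) : (finsupp (dec v) `<=` A)%fset ->
  v = \sum_(a <- A) dec v a.
Proof.
move=> sA; rewrite {1}(decP v).2; apply: big_fset_incl => // a _.
by move=> /fsfun_dflt.
Qed.

Lemma dec_eq v (A : {fset 'rV[int]_n}) (g : 'rV[int]_n -> V) :
  (forall a, gcomp a (g a)) -> (forall a, a \notin A -> g a = 0) ->
  v = \sum_(a <- A) g a -> dec v =1 g.
Proof.
move=> hg gA ->; set f := [fsfun a in A => g a | 0].
have fE a : f a = g a by rewrite fsfunE; case: ifPn => // /gA.
rewrite (@dec_uniq _ f) //; split=> [a|]; first by rewrite fE.
rewrite (eq_bigr f) => [|a _]; last by rewrite fE.
symmetry; apply: big_fset_incl => [|a _ /fsfun_dflt //].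
by apply/fsubsetP => a; rewrite mem_finsupp fE; apply: contraNT => /gA ->.
Qed.

Lemma dec_linear a c (u v : V) : dec (c *: u + v) a = c *: dec u a + dec v a.
Proof.
pose A := (finsupp (dec u) `|` finsupp (dec v))%fset.
apply: (@dec_eq _ A (fun a => c *: dec u a + dec v a)) => [b|b|].
- by apply: gcompL; apply: (decP _).1.
- rewrite in_fsetU negb_or => /andP[hu hv].
  by rewrite (fsfun_dflt hu) (fsfun_dflt hv) scaler0 addr0.
- rewrite big_split /= -scaler_sumr -!dec_sum //; first exact: fsubsetUr.
  exact: fsubsetUl.
Qed.

Lemma dec_hom a v b : gcomp a v -> dec v b = if b == a then v else 0.
Proof.
move=> hv.
apply: (@dec_eq _ [fset a]%fset (fun b => if b == a then v else 0)) => [c|c|].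
- by case: eqP => [->//|_]; apply: gcomp0.
- by rewrite in_fset1 => /negbTE->.
- by rewrite big_seq_fset1 eqxx.
Qed.

Definition hcomps (v : V) : seq ('rV[int]_n * V) :=
  [seq (a, dec v a) | a <- finsupp (dec v)].

(* The words of homogeneous letters (tagged with their degrees) obtained by
   expanding each letter of a word into its homogeneous components.          *)
Fixpoint hexpand (s : seq V) : seq (seq ('rV[int]_n * V)) :=
  if s is v :: s' then [seq x :: d | x <- hcomps v, d <- hexpand s'] else [:: [::]].

Definition homw (d : seq ('rV[int]_n * V)) := forall x, x \in d -> gcomp x.1 x.2.

Definition degw (d : seq ('rV[int]_n * V)) : 'rV[int]_n := \sum_(x <- d) x.1.

Definition letters (d : seq ('rV[int]_n * V)) : seq V := [seq x.2 | x <- d].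

Definition homsum (U : lmodType K) (F : seq ('rV[int]_n * V) -> U) (s : seq V) : U :=
  \sum_(d <- hexpand s) F d.

(* Linearity in each letter, the degree tags being fixed. *)
Definition multilin (U : lmodType K) (F : seq ('rV[int]_n * V) -> U) :=
  forall d1 d2 a c x y, F (d1 ++ (a, c *: x + y) :: d2) =
    c *: F (d1 ++ (a, x) :: d2) + F (d1 ++ (a, y) :: d2).

Lemma multilin_cons U F x : @multilin U F -> multilin (fun d => F (x :: d)).
Proof. by move=> hF d1 d2 a c y z; rewrite -!cat_cons hF. Qed.

Lemma multilin0 U F d1 d2 a : @multilin U F -> F (d1 ++ (a, 0) :: d2) = 0.
Proof.
move=> hF; have := hF d1 d2 a 1 0 0.
rewrite addr0 scaler0 scale1r => /esym/eqP.
by rewrite -subr_eq0 addrK => /eqP.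
Qed.

Lemma multilin0_cons U F a d : @multilin U F -> F ((a, 0) :: d) = 0.
Proof. by move=> hF; apply: (multilin0 [::]). Qed.

Lemma homsum_cons U F v s : @homsum U F (v :: s) =
  \sum_(a <- finsupp (dec v)) homsum (fun d => F ((a, dec v a) :: d)) s.
Proof.
rewrite /homsum /= big_allpairs_dep /hcomps big_map.
by apply: eq_bigr.
Qed.

Lemma homsum_cons_sub U F v s (A : {fset 'rV[int]_n}) : multilin F ->
  (finsupp (dec v) `<=` A)%fset ->
  @homsum U F (v :: s) = \sum_(a <- A) homsum (fun d => F ((a, dec v a) :: d)) s.
Proof.
move=> hF sA; rewrite homsum_cons; apply: big_fset_incl => // a _ /fsfun_dflt ->.
by rewrite /homsum big1 // => d _; rewrite multilin0_cons.
Qed.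

Lemma homsum_multi U F s1 s2 c x y : @multilin U F ->
  homsum F (s1 ++ (c *: x + y) :: s2) =
  c *: homsum F (s1 ++ x :: s2) + homsum F (s1 ++ y :: s2).
Proof.
elim: s1 F => [|v s1 IH] F hF /=; last first.
  rewrite !homsum_cons scaler_sumr -big_split /=; apply: eq_bigr => a _.
  by apply: IH; apply: multilin_cons.
pose A := (finsupp (dec x) `|` finsupp (dec y) `|` finsupp (dec (c *: x + y)))%fset.
rewrite !(@homsum_cons_sub _ _ _ _ A) //;
  try by apply/fsubsetP => b; rewrite !in_fsetU => ->; rewrite ?orbT.
rewrite scaler_sumr -big_split /=; apply: eq_bigr => a _.
rewrite dec_linear /homsum scaler_sumr -big_split /=; apply: eq_bigr => d _.
exact: (hF [::]).
Qed.

Lemma homsum_hom U F d : @multilin U F -> homw d -> homsum F (letters d) = F d.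
Proof.
elim: d F => [|[a v] d IH] F hF hd /=; first by rewrite /homsum big_seq1.
have hv : gcomp a v by apply: (hd (a, v)); rewrite mem_head.
have hsub : (finsupp (dec v) `<=` [fset a])%fset.
  apply/fsubsetP => b; rewrite mem_finsupp (dec_hom b hv) in_fset1.
  by case: (b =P a) => //; rewrite eqxx.
rewrite (homsum_cons_sub _ hF hsub) big_seq_fset1 (dec_hom _ hv) eqxx.
rewrite IH //; first exact: multilin_cons.
by move=> x xd; apply: hd; rewrite inE xd orbT.
Qed.

Lemma hexpand_hom s d : d \in hexpand s -> homw d.
Proof.
elim: s d => [|v s IH] d /=; first by rewrite inE => /eqP -> x.
move=> /allpairsP[[x d'] /= [hx hd' ->]] y; rewrite inE => /predU1P[->|]; last exact: IH.
by move: hx => /mapP[a _ ->]; apply: (decP _).1.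
Qed.

Lemma homsum_letters (U : lmodType K) (f : seq V -> U) s :
  (forall s1 s2 c x y, size (s1 ++ x :: s2) = size s ->
    f (s1 ++ (c *: x + y) :: s2) = c *: f (s1 ++ x :: s2) + f (s1 ++ y :: s2)) ->
  homsum (fun d => f (letters d)) s = f s.
Proof.
elim: s f => [|v s IH] f hf; first by rewrite /homsum big_seq1.
have hD x y : f ((x + y) :: s) = f (x :: s) + f (y :: s).
  by have := hf [::] s 1 x y erefl; rewrite !scale1r.
have h0 : f (0 :: s) = 0.
  by apply: (@addrI _ (f (0 :: s))); rewrite -hD !addr0.
rewrite homsum_cons.
transitivity (\sum_(a <- finsupp (dec v)) f (dec v a :: s)).
  apply: eq_bigr => a _; apply: (IH (fun s' => f (dec v a :: s'))) => s1 s2 c x y hs.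
  by apply: (hf (_ :: s1)); rewrite /= hs.
rewrite [in RHS](decP v).2; elim: (enum_fset _) => [|a A IHA].
  by rewrite !big_nil h0.
by rewrite !big_cons hD IHA.
Qed.

End Components.

Lemma grading_of_proj (V : lmodType K) (comp : 'rV[int]_n -> set V)
    (P : 'rV[int]_n -> V -> V) :
  (forall a, comp a 0 /\
    forall c x y, comp a x -> comp a y -> comp a (c *: x + y)) ->
  (forall a, linear (P a)) ->
  (forall a b v, comp a v -> P b v = if b == a then v else 0) ->
  (forall v, in_span (fun u => exists a, comp a u) v) ->
  forall v, exists! f, is_homdec comp v f.
Proof.
move=> hsub hlin hP hspan v.
have P0 a : P a 0 = 0.
  have := hlin a 1 0 0; rewrite !scale1r addr0 => /esym/eqP.
  by rewrite -subr_eq0 addrK => /eqP.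
have [A [hA hv]] : exists A : {fset 'rV[int]_n},
    (forall a, a \notin A -> P a v = 0) /\
    ((forall a, comp a (P a v)) /\ v = \sum_(a <- A) P a v).
  elim: (hspan v) => [|c u w [a ha] _ [A [hA [hc hw]]]].
    exists fset0; split=> [a _|]; first exact: P0.
    by split=> [a|]; [rewrite P0; apply: (hsub a).1 | rewrite big_seq_fset0].
  exists (a |` A)%fset; split=> [b|].
    rewrite in_fset1U negb_or hlin (hP _ _ _ ha) => /andP[/negbTE-> /hA ->].
    by rewrite scaler0 addr0.
  split=> [b|].
    rewrite hlin; apply: (hsub b).2 => //.
    by rewrite (hP _ _ _ ha); case: eqP => [->//|_]; apply: (hsub b).1.
  under eq_bigr => b _ do rewrite hlin (hP _ _ _ ha).
  rewrite big_split /= -scaler_sumr; congr (c *: _ + _).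
    rewrite (big_fsetD1 a) ?in_fset1U ?eqxx //= big_seq_cond big1 ?addr0 //.
    by move=> b; rewrite in_fsetD1 andbT => /andP[/negbTE-> _].
  rewrite [LHS]hw; apply: big_fset_incl; first exact: fsubsetU1.
  by move=> b _ /hA.
exists [fsfun a in A => P a v | 0]; split.
  have fE a : [fsfun a in A => P a v | 0] a = P a v.
    by rewrite fsfunE; case: ifPn => // /hA.
  split=> [a|]; first by rewrite fE; apply: hv.1.
  rewrite {1}hv.2 (eq_bigr _ (fun a _ => esym (fE a))).
  symmetry; apply: big_fset_incl => [|a _ /fsfun_dflt //].
  by apply/fsubsetP => a; rewrite mem_finsupp fE; apply: contraNT => /hA ->.
move=> f [hf vE]; apply/fsfunP => b; rewrite fsfunE.
suff -> : f b = P b v by case: ifPn => // /hA.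
have hsum (r : seq 'rV[int]_n) (g : 'rV[int]_n -> V) :
    P b (\sum_(a <- r) g a) = \sum_(a <- r) P b (g a).
  elim: r => [|a r IH]; first by rewrite !big_nil P0.
  by rewrite !big_cons -[g a in LHS]scale1r hlin scale1r IH.
rewrite vE hsum (eq_bigr _ (fun a _ => hP a b _ (hf a))).
have [bf|bf] := boolP (b \in finsupp f).
  rewrite (big_fsetD1 b) //= eqxx big_seq_cond big1 ?addr0 // => a.
  by rewrite in_fsetD1 andbT eq_sym => /andP[/negbTE-> _].
rewrite (fsfun_dflt bf) big_seq big1 // => a af.
by case: eqP => // ab; rewrite ab af in bf.
Qed.

End Graded.

(* T(W) = \bigoplus_(p >= 1) W^{\otimes p}, presented by the words in W modulo
   linearity in each letter. The relations preserve the length of words, so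
   that words of length p span W^{\otimes p}; the empty word is set to 0, as
   there is no component p = 0.                                              *)
Section TensorSpace.
Variables (K : fieldType) (n : nat) (W : gradedSpace K n).

Definition tens_rel : set {freeg (seq W) / K} := fun r =>
  r = << [::] >> \/
  exists s1 s2 c x y, r = << s1 ++ (c *: x + y) :: s2 >>
    - (c *: << s1 ++ x :: s2 >> + << s1 ++ y :: s2 >>).

Definition tensMod : lmodType K := pres tens_rel.

Definition tens (s : seq W) : tensMod := pgen tens_rel s.

Lemma tens_rel_lift (U : lmodType K) (f : seq W -> U) :
  f [::] = 0 ->
  (forall s1 s2 c x y,
    f (s1 ++ (c *: x + y) :: s2) = c *: f (s1 ++ x :: s2) + f (s1 ++ y :: s2)) ->
  forall r, tens_rel r -> fglift f r = 0.
Proof.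
move=> f0 fD r [->|[s1 [s2 [c [x [y ->]]]]]]; first by rewrite liftU f0 scaler0.
rewrite addrC -scaleN1r fglift_linear fglift_linear !liftU !scale1r fD.
by rewrite scaleN1r addNr.
Qed.

Lemma tens_nil : tens [::] = 0.
Proof.
rewrite /tens /pgen -(qpi0 tens_rel); apply: qpi_eq.
by rewrite subr0; apply: span_gen; left.
Qed.

Lemma tens_multi s1 s2 c x y :
  tens (s1 ++ (c *: x + y) :: s2) = c *: tens (s1 ++ x :: s2) + tens (s1 ++ y :: s2).
Proof.
rewrite /tens /pgen -qpiZ -qpiD; apply: qpi_eq; apply: span_gen; right.
by exists s1, s2, c, x, y.
Qed.

(* For F linear in each letter, the linear map on T(W) sending
   w_1 \otimes .. \otimes w_p, with w_i homogeneous of degree a_i, to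
   F [:: (a_1, w_1); ..; (a_p, w_p)] (see tlift_hom, tlift_linear).          *)
Definition tlift (U : lmodType K) (F : seq ('rV[int]_n * W) -> U) : tensMod -> U :=
  plift (homsum F).

Lemma tlift_rel (U : lmodType K) (F : seq ('rV[int]_n * W) -> U) :
  F [::] = 0 -> multilin F -> forall r, tens_rel r -> fglift (homsum F) r = 0.
Proof.
move=> F0 hF; apply: tens_rel_lift; first by rewrite /homsum big_seq1.
by move=> *; apply: homsum_multi.
Qed.

Lemma tlift_linear (U : lmodType K) (F : seq ('rV[int]_n * W) -> U) :
  F [::] = 0 -> multilin F -> linear (tlift F).
Proof. by move=> F0 hF; apply: plift_linear; apply: tlift_rel. Qed.

Lemma tlift_tens (U : lmodType K) (F : seq ('rV[int]_n * W) -> U) s :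
  F [::] = 0 -> multilin F -> tlift F (tens s) = homsum F s.
Proof. by move=> F0 hF; apply: plift_gen; apply: tlift_rel. Qed.

Lemma tlift_hom (U : lmodType K) (F : seq ('rV[int]_n * W) -> U) d :
  F [::] = 0 -> multilin F -> homw d -> tlift F (tens (letters d)) = F d.
Proof. by move=> F0 hF hd; rewrite tlift_tens // homsum_hom. Qed.

Definition tcomp (a : 'rV[int]_n) : set tensMod :=
  in_span (fun t => exists d, [/\ homw d, degw d = a & t = tens (letters d)]).

Definition tproj (a : 'rV[int]_n) : tensMod -> tensMod :=
  tlift (fun d => if degw d == a then tens (letters d) else 0).

Lemma degw_cat d1 d2 : degw (d1 ++ d2) = degw d1 + degw (d2 : seq ('rV[int]_n * W)).
Proof. by rewrite /degw big_cat. Qed.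

Lemma degw_cons x d : degw (x :: d) = x.1 + degw (d : seq ('rV[int]_n * W)).
Proof. by rewrite /degw big_cons. Qed.

Lemma tproj_multi a :
  multilin (fun d : seq ('rV[int]_n * W) => if degw d == a then tens (letters d) else 0).
Proof.
move=> d1 d2 b c x y; rewrite !degw_cat !degw_cons /=.
case: ifP => _; last by rewrite scaler0 addr0.
by rewrite /letters !map_cat /= tens_multi.
Qed.

Lemma tproj_nil a :
  (if degw ([::] : seq ('rV[int]_n * W)) == a then tens (letters [::]) else 0) = 0.
Proof. by rewrite tens_nil if_same. Qed.

Lemma tcomp_sub a : tcomp a 0 /\
  forall c x y, tcomp a x -> tcomp a y -> tcomp a (c *: x + y).
Proof.
split; first exact: in_span0.
by move=> c x y hx hy; apply: span_add => //; apply: span_scale.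
Qed.

Lemma tproj_linear a : linear (tproj a).
Proof. exact: tlift_linear (tproj_nil a) (@tproj_multi a). Qed.

Lemma tproj_comp a b t : tcomp a t -> tproj b t = if b == a then t else 0.
Proof.
elim=> [|c x u [d [hd da ->]] _ IH].
  by rewrite (linear_0 (@tproj_linear b)) if_same.
rewrite tproj_linear IH /tproj tlift_hom //; [| exact: tproj_nil | exact: tproj_multi].
by rewrite da eq_sym; case: ifP => // _; rewrite scaler0 addr0.
Qed.

Lemma tens_expand s : tens s = \sum_(d <- hexpand s) tens (letters d).
Proof.
by rewrite -(@homsum_letters _ _ W _ tens) // => s1 s2 c x y _; apply: tens_multi.
Qed.

Lemma tcomp_span t : in_span (fun u => exists a, tcomp a u) t.
Proof.
elim/pres_ind: t => [|c s t ht]; first exact: in_span0.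
apply: span_add => //; apply: span_scale.
have -> : pgen tens_rel s = tens s by [].
rewrite tens_expand big_seq; elim/big_rec: _ => [|d u hd hu]; first exact: in_span0.
apply: span_add => //; apply: span_gen; exists (degw d).
by apply: span_gen; exists d; split => //; apply: hexpand_hom hd.
Qed.

Definition tensG : gradedSpace K n :=
  GradedSpace tcomp_sub (grading_of_proj tcomp_sub tproj_linear tproj_comp tcomp_span).

End TensorSpace.

Section BinaryTensor.
Variables (K : fieldType).

Definition bil_rel (U V : lmodType K) : set {freeg (U * V) / K} := fun r =>
  (exists c x y v,
     r = << (c *: x + y, v) >> - (c *: << (x, v) >> + << (y, v) >>)) \/
  (exists c u x y,
     r = << (u, c *: x + y) >> - (c *: << (u, x) >> + << (u, y) >>)).

Definition otimes (U V : lmodType K) : lmodType K := pres (@bil_rel U V).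

Definition opure (U V : lmodType K) (u : U) (v : V) : otimes U V :=
  pgen (@bil_rel U V) (u, v).

(* The tensor product f \otimes g of linear maps, g being of weight Q:
   u \otimes v |-> (-1)^<Q,u> f(u) \otimes g(v) for u homogeneous.           *)
Definition otimes_map n (U : gradedSpace K n) (V U' V' : lmodType K)
    (Q : 'rV[int]_n) (f : U -> U') (g : V -> V') : otimes U V -> otimes U' V' :=
  plift (fun uv : U * V => \sum_(a <- finsupp (dec uv.1))
    sgn K (dot Q a) *: opure (f (dec uv.1 a)) (g uv.2)).

End BinaryTensor.

Section TensorCoalgebra.
Variables (K : fieldType) (n : nat) (W : gradedSpace K n).
Local Notation word := (seq ('rV[int]_n * W)).
Local Notation TW := (tensG W).

(* The subword indexed by I, in increasing order; positions are numbered from 0. *)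
Definition subword m (d : word) (I : {set 'I_m}) : word :=
  [seq nth (0, 0) d i | i : 'I_m <- enum I].

Definition koszul m (d : word) (I J : {set 'I_m}) : int :=
  \sum_(i in I) \sum_(j in J | (j < i)%N)
    dot (nth (0, 0) d i).1 (nth (0, 0) d j).1.

Definition coprod : TW -> otimes TW TW :=
  tlift (fun d : word => \sum_(I : {set 'I_(size d).-1} | I != finset.set0)
    sgn K (koszul d I (~: I)) *:
    opure (tens (letters (subword d I)) : TW)
          (tens (rcons (letters (subword d (~: I))) (last (0, 0) d).2) : TW)).

Definition is_coder (Q : 'rV[int]_n) (R : TW -> TW) :=
  [/\ linear R, has_weight Q R
    & forall t, coprod (R t) =
        otimes_map (0 : 'rV[int]_n) R id (coprod t) + otimes_map Q id R (coprod t)].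

Definition tproj1 : TW -> W := plift (fun s : seq W => if s is [:: w] then w else 0).

(* Corestrictions Q_p : W^{\otimes p} -> W; here they are glued over p into a
   single map T(W) -> W, which restricts to Q_p on words of length p.        *)
Definition corestr (R : TW -> TW) : TW -> W := fun t => tproj1 (R t).

Definition CoDer (Q : 'rV[int]_n) (p : nat) : set (TW -> TW) := fun R =>
  is_coder Q R /\ forall s : seq W, size s != p -> corestr R (tens s) = 0.

Definition CoDiff (Q : 'rV[int]_n) (p : nat) : set (TW -> TW) := fun R =>
  CoDer Q p R /\ forall t, R (R t) = 0.

(* The weight Q coderivation with corestrictions q. In the sum over the
   partitions I, J, K of the positions with I, J < K, the set K is a final
   segment {k, k+1, ..} and J is the complement of I in {0, .., k-1}.        *)
Definition coder_of (Q : 'rV[int]_n) (q : TW -> W) : TW -> TW :=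
  tlift (fun d : word => \sum_(k < size d) \sum_(I : {set 'I_k})
    sgn K (koszul d I (~: I) + dot Q (degw (subword d I))) *:
    tens (letters (subword d I) ++
          q (tens (rcons (letters (subword d (~: I))) (nth (0, 0) d k).2)) ::
          letters (drop k.+1 d))).

End TensorCoalgebra.

Section Desuspension.
Variables (K : fieldType) (n : nat).

Definition e1 : 'rV[int]_n.+1 := delta_mx ord0 ord0.

Variable V : gradedSpace K n.+1.

Definition dcomp (a : 'rV[int]_n.+1) : set V := gcomp (a + e1).

Lemma dcomp_sub a : dcomp a 0 /\
  forall c x y, dcomp a x -> dcomp a y -> dcomp a (c *: x + y).
Proof. exact: gcomp_sub. Qed.

Lemma dcomp_dec (v : V) : exists! f, is_homdec dcomp v f.
Proof.
apply: (grading_of_proj (P := fun a v => dec v (a + e1))) => //.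
- exact: dcomp_sub.
- by move=> a c x y; apply: dec_linear.
- by move=> a b x hx; rewrite (dec_hom _ hx) (inj_eq (addIr _)).
move=> x; rewrite (decP x).2; elim/big_rec: _ => [|a u _ hu]; first exact: in_span0.
apply: span_add => //; apply: span_gen; exists (a - e1).
by rewrite /dcomp subrK; apply: (decP x).1.
Qed.

Definition desusp : gradedSpace K n.+1 := GradedSpace dcomp_sub dcomp_dec.

Definition down : V -> desusp := fun v => v.
Definition up : desusp -> V := fun v => v.

(* Exponent of the sign in up^{\otimes p} = up \otimes up^{\otimes (p-1)}, by
   the sign convention for tensor products of maps.                          *)
Fixpoint up_exp (d : seq ('rV[int]_n.+1 * desusp)) : int :=
  if d is x :: d' then dot (e1 *+ size d') x.1 + up_exp d' else 0.

(* The map T(desusp V) -> T(V) equal to up^{\otimes p} on words of length p. *)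
Definition up_tens : tensG desusp -> tensG V :=
  tlift (fun d => sgn K (up_exp d) *: tens [seq up v | v <- letters d]).

End Desuspension.

Section StemBracket.
Variables (K : fieldType) (n : nat) (V : gradedSpace K n.+1).

(* p-linear maps V^p -> V are encoded as functions on words in V that vanish
   on words of length different from p.                                      *)
Definition is_plinear (p : nat) (m : seq V -> V) :=
  (forall s, size s != p -> m s = 0) /\
  (forall s1 s2 c x y, (size s1 + size s2).+1 = p ->
     m (s1 ++ (c *: x + y) :: s2) = c *: m (s1 ++ x :: s2) + m (s1 ++ y :: s2)).

Definition Mcomp (A : 'rV[int]_n.+1) (a : nat) : set (seq V -> V) := fun m =>
  is_plinear a.+1 m /\
  forall d : seq ('rV[int]_n.+1 * V), homw d -> size d = a.+1 ->
    gcomp (A + degw d) (m (letters d)).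

Definition Lod : set (seq V -> V) := fun m =>
  Mcomp 0 1 m /\
  forall al be ga (a b c : V), gcomp al a -> gcomp be b -> gcomp ga c ->
    m [:: a; m [:: b; c]] =
      m [:: m [:: a; b]; c] + sgn K (dot al be) *: m [:: b; m [:: a; c]].

Definition mext (m : seq V -> V) : tensG V -> V := plift m.

(* [down \o mext m \o up_tens] vanishes on words of length different from a + 1. *)
Definition phi (A : 'rV[int]_n.+1) (a : nat) (m : seq V -> V) :
    tensG (desusp V) -> tensG (desusp V) :=
  coder_of (A + e1 n *+ a)
    (fun t => (-1) ^+ (a * a.+1)./2 *: down (mext m (up_tens t))).

(* The inverse of phi_(A,a), as a bijection from M^(A,a)(V) onto
   CoDer^(A + a e1)_(a+1); the value 0 off the image of phi is irrelevant.   *)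
Definition phi_inv (A : 'rV[int]_n.+1) (a : nat)
    (R : tensG (desusp V) -> tensG (desusp V)) : seq V -> V :=
  xget (fun _ : seq V => 0 : V) [set m | Mcomp A a m /\ phi A a m = R].

Definition gcomm (Q Q' : 'rV[int]_n.+1)
    (R R' : tensG (desusp V) -> tensG (desusp V)) :
    tensG (desusp V) -> tensG (desusp V) :=
  fun t => R (R' t) - sgn K (dot Q Q') *: R' (R t).

Definition stem (A : 'rV[int]_n.+1) (a : nat) (m : seq V -> V)
    (B : 'rV[int]_n.+1) (b : nat) (m' : seq V -> V) : seq V -> V :=
  sgn K (1 + dot (e1 n *+ a) (e1 n *+ b + B)) *:
  phi_inv (A + B) (a + b)
    (gcomm (A + e1 n *+ a) (B + e1 n *+ b) (phi A a m) (phi B b m')).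

(* M_r(V), as a subspace of the space of all functions on words. *)
Definition Mr_set : set (seq V -> V) := fun m => exists A a, Mcomp A a m.

Record Mr := MkMr { mval :> seq V -> V; _ : mval \in spanp Mr_set }.

HB.instance Definition _ := [isSub for mval].
HB.instance Definition _ := [Choice of Mr by <:].
HB.instance Definition _ := [SubChoice_isSubLmodule of Mr by <:].

(* Z^n x Z is identified with 'rV[int]_(n + 1). *)
Definition mdeg (A : 'rV[int]_n.+1) (a : int) : 'rV[int]_(n.+1 + 1) :=
  row_mx A (const_mx a).

Definition mdeg1 (w : 'rV[int]_(n.+1 + 1)) : 'rV[int]_n.+1 := lsubmx w.
Definition mdeg2 (w : 'rV[int]_(n.+1 + 1)) : int := rsubmx w ord0 ord0.

Definition Mr_comp (w : 'rV[int]_(n.+1 + 1)) : set Mr := fun x =>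
  if mdeg2 w is Posz a then Mcomp (mdeg1 w) a (mval x) else x = 0.

Lemma fctL c (x y : seq V -> V) s : (c *: x + y) s = c *: x s + y s.
Proof. by []. Qed.

Lemma mvalL c (x y : Mr) s : mval (c *: x + y) s = c *: mval x s + mval y s.
Proof. by rewrite -[mval]/(val : Mr -> _) linearP. Qed.

Lemma mval0 s : mval 0 s = 0.
Proof. by rewrite -[mval]/(val : Mr -> _) linear0. Qed.

Lemma Mcomp_sub A a : Mcomp A a 0 /\
  forall c x y, Mcomp A a x -> Mcomp A a y -> Mcomp A a (c *: x + y).
Proof.
split; first split; first split.
- by [].
- by move=> *; rewrite /= scaler0 addr0.
- by move=> d _ _; apply: gcomp0.
move=> c x y [[x1 x2] x3] [[y1 y2] y3]; split; first split.
- by move=> s hs; rewrite fctL x1 // y1 // scaler0 addr0.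
- move=> s1 s2 b u v hs; rewrite !fctL x2 // y2 // !scalerDr !scalerA [b * c]mulrC -!addrA.
  by congr (_ + _); rewrite addrCA.
- by move=> d hd sd; apply: gcompL; [apply: x3 | apply: y3].
Qed.

Lemma Mr_comp_sub w : Mr_comp w 0 /\
  forall c x y, Mr_comp w x -> Mr_comp w y -> Mr_comp w (c *: x + y).
Proof.
rewrite /Mr_comp; case: (mdeg2 w) => a; last first.
  by split=> // c x y -> ->; rewrite scaler0 addr0.
have [M0 ML] := Mcomp_sub (mdeg1 w) a.
split=> [|c x y hx hy]; first by rewrite -[mval]/(val : Mr -> _) linear0.
by rewrite -[mval]/(val : Mr -> _) linearP; apply: ML.
Qed.

Definition Mr_projf (w : 'rV[int]_(n.+1 + 1)) (m : seq V -> V) : seq V -> V :=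
  fun s => if mdeg2 w is Posz a then
    if size s == a.+1 then
      homsum (fun d => dec (m (letters d)) (mdeg1 w + degw d)) s
    else 0 else 0.

Lemma Mr_projf_linear w : linear (Mr_projf w).
Proof.
move=> c x y; apply/funext => s; rewrite fctL /Mr_projf.
case: (mdeg2 w) => a; last by rewrite scaler0 addr0.
case: ifP => _; last by rewrite scaler0 addr0.
rewrite /homsum scaler_sumr -big_split /=; apply: eq_bigr => d _.
exact: dec_linear.
Qed.

Lemma size_hexpand (s : seq V) d : d \in hexpand s -> size d = size s.
Proof.
elim: s d => [|v s IH] d /=; first by rewrite inE => /eqP->.
by move=> /allpairsP[[x d'] /= [_ hd' ->]] /=; rewrite IH.
Qed.

Lemma Mr_projf_comp A a w m : Mcomp A a m ->
  Mr_projf w m = if w == mdeg A a then m else 0.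
Proof.
move=> [[m1 m2] m3]; apply/funext => s; rewrite /Mr_projf.
have wE : (w == mdeg A a) = (mdeg1 w == A) && (mdeg2 w == a).
  apply/eqP/andP => [->|[/eqP wA /eqP wa]].
    by rewrite /mdeg1 /mdeg2 row_mxKl row_mxKr mxE !eqxx.
  rewrite -[w]hsubmxK /mdeg; congr row_mx; first exact: wA.
  by apply/matrixP => i j; rewrite !ord1 -[LHS]/(mdeg2 w) wa mxE.
rewrite wE; case: (mdeg2 w) => b; last by rewrite andbF.
rewrite eqz_nat.
have [sb|sb] := eqVneq (size s) b.+1; last first.
  by case: ifP => // /andP[_ /eqP ba]; rewrite m1 // -ba.
have [ba|ba] := eqVneq b a; last first.
  rewrite andbF /homsum big_seq big1 // => d hd.
  rewrite m1 ?(dec_hom _ (gcomp0 V 0)) ?if_same //.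
  by rewrite size_map (size_hexpand hd) sb eqSS.
have hs d : d \in hexpand s ->
    dec (m (letters d)) (mdeg1 w + degw d) = if mdeg1 w == A then m (letters d) else 0.
  move=> hd; rewrite (dec_hom _ (m3 d _ _)) ?(inj_eq (addIr _)) //.
  - exact: hexpand_hom hd.
  - by rewrite (size_hexpand hd) sb ba.
rewrite andbT /homsum big_seq (eq_bigr _ hs) -big_seq.
case: ifP => _; last by rewrite big1.
apply: (homsum_letters (f := m)) => s1 s2 c x y hsz; apply: m2.
by rewrite -ba -sb -hsz size_cat /= addnS.
Qed.

Lemma Mr_projf_mem w (x : Mr) : Mr_projf w (mval x) \in spanp Mr_set.
Proof.
case: x => m /= /asboolP hm; apply/asboolP.
have h0 : Mr_projf w 0 = 0 by apply: linear_0; apply: Mr_projf_linear.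
elim: hm => [|c u v [A [a hu]] _ IH]; first by rewrite h0; apply: in_span0.
rewrite Mr_projf_linear (Mr_projf_comp _ hu).
apply: span_add => //; apply: span_scale; case: ifP => _; last exact: in_span0.
by apply: span_gen; exists A, a.
Qed.

Definition Mr_proj w (x : Mr) : Mr := MkMr (Mr_projf_mem w x).

Lemma Mr_proj_linear w : linear (Mr_proj w).
Proof.
by move=> c x y; apply/val_inj; rewrite linearP /= -Mr_projf_linear.
Qed.

Lemma Mr_proj_comp w w' x : Mr_comp w x -> Mr_proj w' x = if w' == w then x else 0.
Proof.
rewrite /Mr_comp; case E: (mdeg2 w) => [a|a]; last first.
  by move=> ->; rewrite (linear_0 (Mr_proj_linear w')) if_same.
have hw : mdeg (mdeg1 w) a = w.
  rewrite -[RHS]hsubmxK /mdeg; congr row_mx.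
  by apply/matrixP => i j; rewrite !ord1 -[RHS]/(mdeg2 w) E mxE.
move=> hx; apply/val_inj; rewrite /= (Mr_projf_comp _ hx) hw.
by case: ifP => // _; rewrite -[mval]/(val : Mr -> _) linear0.
Qed.

Lemma Mr_comp_mdeg A (a : nat) x : Mcomp A a (mval x) -> Mr_comp (mdeg A a) x.
Proof. by rewrite /Mr_comp /mdeg1 /mdeg2 /mdeg row_mxKl row_mxKr mxE. Qed.

Lemma Mr_span x : in_span (fun u => exists w, Mr_comp w u) x.
Proof.
case: x => m hm; have /asboolP := hm.
move=> h; elim: h hm => [|c u v [A [a hu]] hv IH] hm.
  have -> : MkMr hm = 0 by apply/val_inj; rewrite linear0.
  exact: in_span0.
have um : u \in spanp Mr_set by apply/asboolP/span_gen; exists A, a.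
have vm : v \in spanp Mr_set by apply/asboolP.
have -> : MkMr hm = c *: MkMr um + MkMr vm by apply/val_inj; rewrite linearP.
apply: span_add => //; apply: span_scale; apply: span_gen.
by exists (mdeg A a); apply: Mr_comp_mdeg.
Qed.

Definition MrG : gradedSpace K (n.+1 + 1) :=
  GradedSpace Mr_comp_sub (grading_of_proj Mr_comp_sub Mr_proj_linear Mr_proj_comp Mr_span).

Lemma phi_inv_mem A a R : Mcomp A a (phi_inv A a R).
Proof.
rewrite /phi_inv; case: xgetP => [m _ []//|_].
exact: (Mcomp_sub A a).1.
Qed.

Lemma stem_comp A a m B b m' : Mcomp (A + B) (a + b) (stem A a m B b m').
Proof.
rewrite -[stem _ _ _ _ _ _]addr0.
by apply: (Mcomp_sub _ _).2; [apply: phi_inv_mem | apply: (Mcomp_sub _ _).1].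
Qed.

Lemma stem_mem A a m B b m' : stem A a m B b m' \in spanp Mr_set.
Proof. by apply/asboolP/span_gen; exists (A + B), (a + b)%N; apply: stem_comp. Qed.

Definition stem_hom (v w : 'rV[int]_(n.+1 + 1)) (x y : Mr) : Mr :=
  match mdeg2 v, mdeg2 w with
  | Posz a, Posz b => MkMr (stem_mem (mdeg1 v) a x (mdeg1 w) b y)
  | _, _ => 0
  end.

(* The stem bracket on M_r(V), extended biadditively from homogeneous elements. *)
Definition stem_bracket (x y : MrG) : MrG :=
  \sum_(v <- finsupp (dec x)) \sum_(w <- finsupp (dec y))
    stem_hom v w (dec x v) (dec y w).

End StemBracket.

(* Only the bracket of the graded Lie algebra L enters the definition. *)
Definition canonical_elt (K : fieldType) (m : nat) (L : gradedSpace K m)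
    (br : L -> L -> L) (w : 'rV[int]_m) : set L :=
  fun x => [/\ gcomp w x, odd (absz (dot w w)) & br x x = 0].

Arguments CoDiff {K n} W Q p.
Arguments Lod {K n} V.
Arguments phi {K n} V A a m.
Arguments mval {K n V}.
Arguments stem_bracket {K n} V x y.

(* Main.v *)
Require Import Defs.
From mathcomp Require Import all_boot all_order all_algebra.
From mathcomp Require Import finmap freeg.
From mathcomp Require Import boolp classical_sets functions.

Set Implicit Arguments.
Unset Strict Implicit.
Unset Printing Implicit Defensive.

Import GRing.Theory.
Local Open Scope classical_set_scope.
Local Open Scope ring_scope.

(** A binary bracket [m] of weight 0 on [V] corresponds to a weight [e1] map
q from the twofold tensor power of the desuspension W to W, and q is the only
corestriction of a unique coderivation R of T(W). The theorem says that R
squares to zero exactly when [m] is a Loday bracket, and rests on four facts.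

1. The explicit formula with corestrictions q defines a coderivation
([coder_of_coder]). Both the coproduct and the coderivation are sums over
unshuffles of a word; splitting off the first letter x turns these sums into
the recursions
- D(x v) = (x ⊗ 1) D(v) + (1 ⊗ x) D(v),
- R_q(x v) = q(x) v + (-1)^<q,x> x R_q(v) + R_(q(x -))(v),
with D the coproduct enlarged by the term 1 ⊗ v. The coderivation property
then follows by induction on the length of the word, simultaneously for all
corestrictions q, since the third term of R_q involves the new corestriction
q(x -) ([coprod_word_coder_word]).

2. A coderivation is determined by its corestrictions ([coder_eq]): the
coproduct is injective up to letters, because its summand u ⊗ w with w a
single letter retains the whole word u w, and on a word of length p the
coproduct involves only shorter words. With 1, this makes [phi] a bijection onto
the coderivations with a single corestriction ([phi_inj], [phi_surj]).

3. The graded commutator of coderivations is a coderivation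
([commutator_coder]).

4. The square of R is half of the commutator of R with itself, as R is odd and
the characteristic is 0; hence it vanishes as soon as its corestrictions do.
Only the one on words of three letters can be nonzero, and it is the Loday
identity up to a sign ([corestr_phi_sqr3]).

For the second part, the stem bracket of [m] with itself is, up to a sign, the
preimage under [phi] of this commutator, so it vanishes exactly when the square
of R does ([stem_eq0]). *)

(** * Signs and the pairing of degrees *)

Section Signs.
Variables (K : fieldType) (n : nat).
Implicit Types (a b c : 'rV[int]_n).

Lemma sgnD y z : sgn K (y + z) = sgn K y * sgn K z.
Proof. by rewrite /sgn expfzDr // oppr_eq0 oner_eq0. Qed.

Lemma sgn_sqr z : sgn K z * sgn K z = 1.
Proof. by rewrite /sgn -expfzMl mulrNN mulr1 exp1rz. Qed.

Lemma dotC a b : dot a b = dot b a.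
Proof. by apply: eq_bigr => i _; rewrite mulrC. Qed.

Lemma dotDl a b c : dot (a + b) c = dot a c + dot b c.
Proof. by rewrite -big_split; apply: eq_bigr => i _; rewrite mxE mulrDl. Qed.

Lemma dotDr a b c : dot a (b + c) = dot a b + dot a c.
Proof. by rewrite ![dot a _]dotC dotDl. Qed.

Lemma dot0l a : dot 0 a = 0.
Proof. by rewrite /dot big1 // => i _; rewrite mxE mul0r. Qed.

Lemma dot0r a : dot a 0 = 0.
Proof. by rewrite dotC dot0l. Qed.

Lemma sgn0 : sgn K 0 = 1.
Proof. by []. Qed.

End Signs.

(** * Unshuffle sums on words, by recursion on the first letter *)

Section Words.
Variables (K : fieldType) (n : nat) (W : gradedSpace K n).
Local Notation word := (seq ('rV[int]_n * W)).

Section Sums.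
Variable U : lmodType K.
Implicit Types (F : word -> U) (G : word -> word -> U) (q : word -> W).

(** The signed sum of [G W_I W_J] over all unshuffles (I; J) of the word. Sums
with values in an arbitrary module, indexed by a function of the resulting
words, let a linear map be pushed inside without changing the summation. *)
Fixpoint unshuffle G (d : word) : U :=
  if d is x :: d' then
    unshuffle (fun l r => G (x :: l) r) d' +
    unshuffle (fun l r => sgn K (dot (degw l) x.1) *: G l (x :: r)) d'
  else G [::] [::].

(** The coproduct enlarged by the summand with empty left factor: the last
letter stays last in the right factor. *)
Fixpoint coprod_word G (d : word) : U :=
  if d is x :: d' then
    (if d' is [::] then G [::] [:: x] else 0) +
    (coprod_word (fun l r => G (x :: l) r) d' +
     coprod_word (fun l r => sgn K (dot (degw l) x.1) *: G l (x :: r)) d')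
  else 0.

(** The coderivation with corestrictions [q], composed with [F]. The first
letter x opens the word fed to [q] alone, or stays to the left of it, or belongs
to the argument of [q] with more letters to come; in this last case [q] becomes
[q(x -)], of weight [Q + x]. *)
Fixpoint coder_word (Q : 'rV[int]_n) q F (d : word) : U :=
  if d is x :: d' then
    F ((Q + x.1, q [:: x]) :: d') +
    (sgn K (dot Q x.1) *: coder_word Q q (fun v => F (x :: v)) d' +
     coder_word (Q + x.1) (fun v => q (x :: v)) F d')
  else 0.

Lemma degw_nil : degw ([::] : word) = 0.
Proof. by rewrite /degw big_nil. Qed.

Lemma homw_cons x (d : word) : homw (x :: d) <-> gcomp x.1 x.2 /\ homw d.
Proof.
split=> [h|[hx hd] y].
  by split; [apply: h; rewrite mem_head | move=> y yd; apply: h; rewrite inE yd orbT].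
by rewrite inE => /predU1P[->|/hd].
Qed.

Lemma unshuffle_ext G G' d : (forall l r, G l r = G' l r) ->
  unshuffle G d = unshuffle G' d.
Proof.
elim: d G G' => [|x d IH] G G' h /=; first exact: h.
by congr (_ + _); apply: IH => l r; rewrite h.
Qed.

Lemma unshuffle_scale c G d :
  unshuffle (fun l r => c *: G l r) d = c *: unshuffle G d.
Proof.
elim: d G => [|x d IH] G //=; rewrite scalerDr -!IH; congr (_ + _).
by apply: unshuffle_ext => l r; rewrite !scalerA mulrC.
Qed.

Lemma coprod_word_rcons G d x :
  coprod_word G (rcons d x) = unshuffle (fun l r => G l (rcons r x)) d.
Proof.
elim: d G => [|y d IH] G /=; first by rewrite !addr0.
by rewrite !IH; case: d {IH} => [|z d]; rewrite add0r.
Qed.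

Lemma coder_word_unshuffle Q q F d : coder_word Q q F d = \sum_(k < size d)
  unshuffle (fun l r => let r' := rcons r (nth (0, 0) d k) in
    sgn K (dot Q (degw l)) *: F (l ++ (Q + degw r', q r') :: drop k.+1 d)) (take k d).
Proof.
elim: d Q q F => [|x d IH] Q q F /=; first by rewrite big_ord0.
rewrite big_ord_recl /= drop0 degw_nil dot0r sgn0 scale1r degw_cons degw_nil addr0.
apply: (congr1 (+%R _)); rewrite !IH scaler_sumr -big_split; apply: eq_bigr => k _ /=.
rewrite -unshuffle_scale; congr (_ + _); apply: unshuffle_ext => l r /=.
  by rewrite degw_cons dotDr sgnD scalerA.
rewrite degw_cons addrA scalerA -sgnD.
by rewrite dotDl [dot x.1 _]dotC [dot Q _ + _]addrC.
Qed.

(** Congruence, recording what is known of the two words that occur: it lets an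
identity valid for shorter or homogeneous words be applied under the sum. *)
Lemma coprod_word_eq G G' d :
  (forall l r, (homw d -> homw l /\ homw r) -> degw l + degw r = degw d ->
    (size l + size r = size d)%N -> (size l < size d)%N -> G l r = G' l r) ->
  coprod_word G d = coprod_word G' d.
Proof.
elim: d G G' => [|x d IH] G G' h //=; congr (_ + (_ + _)).
- case: d h {IH} => // h; apply: h => //.
  + by rewrite degw_nil add0r.
- apply: IH => l r h1 h2 h3 h4; apply: h.
  + by move=> /homw_cons[hx /h1[hl hr]]; split=> //; apply/homw_cons.
  + by rewrite !degw_cons -h2 addrA.
  + by rewrite /= -h3.
  + by rewrite /= ltnS.
- apply: IH => l r h1 h2 h3 h4; congr (_ *: _); apply: h.
  + by move=> /homw_cons[hx /h1[hl hr]]; split=> //; apply/homw_cons.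
  + by rewrite !degw_cons -h2 addrCA.
  + by rewrite /= -h3 addnS.
  + by rewrite /= (ltn_trans h4).
Qed.

Lemma coprod_word_linear c G G' d : coprod_word (fun l r => c *: G l r + G' l r) d =
  c *: coprod_word G d + coprod_word G' d.
Proof.
elim: d G G' => [|x d IH] G G' /=; first by rewrite scaler0 addr0.
have -> : coprod_word (fun l r => sgn K (dot (degw l) x.1) *:
    (c *: G l (x :: r) + G' l (x :: r))) d =
    c *: coprod_word (fun l r => sgn K (dot (degw l) x.1) *: G l (x :: r)) d +
    coprod_word (fun l r => sgn K (dot (degw l) x.1) *: G' l (x :: r)) d.
  by rewrite -IH; apply: coprod_word_eq => l r _ _ _ _; rewrite scalerDr !scalerA mulrC.
rewrite (_ : (if d is [::] then c *: G [::] [:: x] + G' [::] [:: x] else 0) =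
    c *: (if d is [::] then G [::] [:: x] else 0) + (if d is [::] then G' [::] [:: x] else 0));
  last by case: (d) => // *; rewrite scaler0 addr0.
by rewrite IH !scalerDr [RHS]addrACA [in RHS](addrACA (c *: coprod_word _ _)).
Qed.

Lemma coprod_word0 d : coprod_word (fun _ _ => 0) d = 0.
Proof.
have := coprod_word_linear 1 (fun _ _ => 0) (fun _ _ => 0) d.
rewrite !scale1r !addr0 => /esym/eqP.
by rewrite -subr_eq0 addrK => /eqP.
Qed.

Lemma coprod_wordD G G' d :
  coprod_word (fun l r => G l r + G' l r) d = coprod_word G d + coprod_word G' d.
Proof.
rewrite -[coprod_word G d]scale1r -coprod_word_linear; apply: coprod_word_eq => l r _ _ _ _.
by rewrite scale1r.
Qed.

Lemma coprod_wordZ c G d : coprod_word (fun l r => c *: G l r) d = c *: coprod_word G d.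
Proof.
rewrite -[RHS]addr0 -[X in _ + X](coprod_word0 d) -coprod_word_linear.
by apply: coprod_word_eq => l r _ _ _ _; rewrite addr0.
Qed.

Lemma coprod_word_multilin G : (forall r, multilin (fun l => G l r)) ->
  (forall l, multilin (G l)) -> multilin (coprod_word G).
Proof.
move=> hl hr d1 d2 a c u v.
elim: d1 G hl hr => [|x d1 IH] G hl hr /=.
  have -> : forall w, coprod_word (fun l r => G ((a, w) :: l) r) d2 =
     coprod_word (fun l r => G ([::] ++ (a, w) :: l) r) d2 by [].
  have -> : forall w, coprod_word (fun l r => sgn K (dot (degw l) a) *: G l ((a, w) :: r)) d2 =
     coprod_word (fun l r => sgn K (dot (degw l) a) *: G l ([::] ++ (a, w) :: r)) d2 by [].
  rewrite (_ : coprod_word (fun l r => G ([::] ++ (a, c *: u + v) :: l) r) d2 =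
    c *: coprod_word (fun l r => G ((a, u) :: l) r) d2 +
    coprod_word (fun l r => G ((a, v) :: l) r) d2);
    last first.
    by rewrite -coprod_word_linear; apply: coprod_word_eq => l r _ _ _ _; rewrite (hl r [::]).
  rewrite (_ : coprod_word (fun l r => sgn K (dot (degw l) a) *:
      G l ([::] ++ (a, c *: u + v) :: r)) d2 =
    c *: coprod_word (fun l r => sgn K (dot (degw l) a) *: G l ((a, u) :: r)) d2 +
    coprod_word (fun l r => sgn K (dot (degw l) a) *: G l ((a, v) :: r)) d2); last first.
    rewrite -coprod_word_linear; apply: coprod_word_eq => l r _ _ _ _.
    by rewrite (hr l [::]) scalerDr !scalerA mulrC.
  rewrite (_ : (if d2 is [::] then G [::] [:: (a, c *: u + v)] else 0) =
      c *: (if d2 is [::] then G [::] [:: (a, u)] else 0) +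
      (if d2 is [::] then G [::] [:: (a, v)] else 0)); last first.
    by case: (d2) => [|*]; [apply: (hr [::] [::] [::]) | rewrite scaler0 addr0].
  by rewrite !scalerDr [RHS]addrACA [in RHS](addrACA (c *: coprod_word _ _)).
have hd w : (if d1 ++ (a, w) :: d2 is [::] then G [::] [:: x] else 0) = 0 by case: (d1).
rewrite !hd !add0r !IH.
- by rewrite scalerDr -!addrA; congr (_ + _); rewrite addrCA.
- move=> r d d' b e s t; rewrite !degw_cat !degw_cons /= hl scalerDr !scalerA.
  by rewrite mulrC.
- by move=> l d d' b e s t; rewrite -!cat_cons hr scalerDr !scalerA mulrC.
- by move=> r d d' b e s t; rewrite -!cat_cons hl.
- by move=> l; apply: hr.
Qed.

Definition word_weight (Q : 'rV[int]_n) q := forall r : word, homw r -> gcomp (Q + degw r) (q r).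

Lemma word_weight_cons Q q x : gcomp x.1 x.2 -> word_weight Q q ->
  word_weight (Q + x.1) (fun r => q (x :: r)).
Proof. by move=> hx hq r hr; rewrite -addrA -degw_cons; apply/hq/homw_cons. Qed.

Lemma coder_word_eq Q q F F' d :
  (forall d', (word_weight Q q -> homw d -> homw d') -> degw d' = Q + degw d ->
    (0 < size d' <= size d)%N -> F d' = F' d') ->
  coder_word Q q F d = coder_word Q q F' d.
Proof.
elim: d Q q F F' => [|x d IH] Q q F F' hF //=.
congr (_ + (_ *: _ + _)).
- apply: hF => //=; last by rewrite !degw_cons addrA.
  move=> hq /homw_cons[hx hd]; apply/homw_cons; split=> //=.
  rewrite -[x.1]addr0 -degw_nil -degw_cons; apply: hq.
  exact/homw_cons.
- apply: IH => d' hd dd /andP[d0 sd]; apply: hF => //.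
    by move=> hq /homw_cons[hx /(hd hq) hd']; apply/homw_cons.
  by rewrite !degw_cons dd addrCA.
- apply: IH => d' hd dd /andP[d0 sd]; apply: hF.
  + by move=> hq /homw_cons[hx]; apply: hd; apply: word_weight_cons.
  + by rewrite dd degw_cons addrA.
  + by rewrite d0 leqW.
Qed.

Lemma coder_word_linear c Q q F F' d :
  coder_word Q q (fun v => c *: F v + F' v) d = c *: coder_word Q q F d + coder_word Q q F' d.
Proof.
elim: d Q q F F' => [|x d IH] Q q F F' /=; first by rewrite scaler0 addr0.
rewrite !IH !scalerDr !scalerA [_ * c]mulrC.
by rewrite [RHS]addrACA; congr (_ + _); rewrite addrACA.
Qed.

Lemma coder_wordZ c Q q F d : coder_word Q q (fun v => c *: F v) d = c *: coder_word Q q F d.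
Proof.
elim: d Q q F => [|x d IH] Q q F /=; first by rewrite scaler0.
by rewrite !IH !scalerDr !scalerA mulrC.
Qed.

Lemma coder_wordD Q q F F' d :
  coder_word Q q (fun v => F v + F' v) d = coder_word Q q F d + coder_word Q q F' d.
Proof.
rewrite -[coder_word Q q F d]scale1r -coder_word_linear; apply: coder_word_eq => d' _ _ _.
by rewrite scale1r.
Qed.

Lemma coder_word0 Q q F d : (forall d', (0 < size d' <= size d)%N -> F d' = 0) ->
  coder_word Q q F d = 0.
Proof.
move=> hF; transitivity (coder_word Q q (fun v => 0 *: F v) d).
  by apply: coder_word_eq => d' _ _ hd; rewrite hF // scaler0.
by rewrite coder_wordZ scale0r.
Qed.

Lemma coder_word_linear_corestr c Q q q1 q2 F d : multilin F ->
  (forall r, q r = c *: q1 r + q2 r) ->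
  coder_word Q q F d = c *: coder_word Q q1 F d + coder_word Q q2 F d.
Proof.
elim: d Q q q1 q2 F => [|x d IH] Q q q1 q2 F hF hq /=; first by rewrite scaler0 addr0.
rewrite (IH _ _ q1 q2) //; last exact: multilin_cons.
rewrite (IH _ (fun v => q (x :: v)) (fun v => q1 (x :: v)) (fun v => q2 (x :: v))) //.
rewrite hq (hF [::]) !scalerDr !scalerA [_ * c]mulrC.
by rewrite [RHS]addrACA; congr (_ + _); rewrite addrACA.
Qed.

Lemma coder_word_multilin Q q F : multilin q -> multilin F -> multilin (coder_word Q q F).
Proof.
move=> hq hF d1 d2 a c u v; elim: d1 Q q F hq hF => [|x d1 IH] Q q F hq hF /=.
  rewrite (hq [::] [::]) (hF [::]).
  rewrite (_ : coder_word Q q (fun w => F ((a, c *: u + v) :: w)) d2 =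
     c *: coder_word Q q (fun w => F ((a, u) :: w)) d2 +
     coder_word Q q (fun w => F ((a, v) :: w)) d2); last first.
    by rewrite -coder_word_linear; apply: coder_word_eq => d3 _ _ _; apply: (hF [::]).
  rewrite (@coder_word_linear_corestr c (Q + a) _
      (fun w => q ((a, u) :: w)) (fun w => q ((a, v) :: w))) //;
    last by move=> r; apply: (hq [::]).
  rewrite !scalerDr !scalerA [_ * c]mulrC.
  by rewrite [RHS]addrACA; congr (_ + _); rewrite addrACA.
rewrite !IH //; try exact: multilin_cons.
rewrite -!(cat_cons (Q + x.1, _)) hF !scalerDr !scalerA [_ * c]mulrC.
by rewrite [RHS]addrACA; congr (_ + _); rewrite addrACA.
Qed.

(** A map that eats r letters leaves a word of length [size d + 1 - r]; if [q]
or [F] vanishes for each such pair of lengths, there is nothing left. *)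
Lemma coder_word_eq0 Q q F d : multilin F ->
  (forall r d', (size r + size d' = (size d).+1)%N -> q r = 0 \/ F d' = 0) ->
  coder_word Q q F d = 0.
Proof.
elim: d Q q F => [|x d IH] Q q F hF hqF //=.
rewrite !IH ?scaler0 ?addr0 //.
- have [->|->//] := hqF [:: x] ((Q + x.1, q [:: x]) :: d) erefl.
  exact: multilin0_cons.
- by move=> r d' h; apply: hqF; rewrite /= -h addSn.
- exact: multilin_cons.
- by move=> r d' h; apply: hqF; rewrite /= -h addnS.
Qed.

Lemma coder_word_sub (S : set U) Q q F d : S 0 ->
  (forall c u v, S u -> S v -> S (c *: u + v)) ->
  (forall d', (word_weight Q q -> homw d -> homw d') -> degw d' = Q + degw d -> S (F d')) ->
  S (coder_word Q q F d).
Proof.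
move=> S0 SL; elim: d Q q F => [|x d IH] Q q F hF //=.
rewrite -[X in S (X + _)]scale1r; apply: (SL); last apply: (SL).
- apply: hF; last by rewrite !degw_cons addrA.
  move=> hq /homw_cons[hx hd]; apply/homw_cons; split=> //=.
  rewrite -[x.1]addr0 -degw_nil -degw_cons; apply: hq.
  exact/homw_cons.
- apply: IH => d' hd dd; apply: hF.
    by move=> hq /homw_cons[hx /(hd hq) hd']; apply/homw_cons.
  by rewrite !degw_cons dd addrCA.
- apply: IH => d' hd dd; apply: hF.
  + by move=> hq /homw_cons[hx]; apply: hd; apply: word_weight_cons.
  + by rewrite dd degw_cons addrA.
Qed.

(** The coderivation property at the level of words: the two summands on the
right are Q ⊗ id and id ⊗ Q. By induction on the word, for all [q] and [G]:
the terms in which [q] takes the first letter x alone, in which x is left of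
[q], and in which x enters [q] with other letters match separately, the induction
hypothesis being applied to [q(x -)] in the last case. No homogeneity is involved, only the degree tags. *)
Lemma coprod_word_coder_word Q q G d :
  coder_word Q q (coprod_word G) d =
  coprod_word (fun l r => coder_word Q q (fun l' => G l' r) l +
                      sgn K (dot Q (degw l)) *: coder_word Q q (G l) r) d.
Proof.
elim: d Q q G => [|x d IH] Q q G //.
rewrite [LHS]/= [RHS]/=; set y := (Q + x.1, _).
rewrite IH.
have -> : coder_word Q q (fun v => (if v is [::] then G [::] [:: x] else 0) +
      (coprod_word (fun l r => G (x :: l) r) v +
       coprod_word (fun l r => sgn K (dot (degw l) x.1) *: G l (x :: r)) v)) d =
    coder_word Q q (coprod_word (fun l r => G (x :: l) r)) d +
    coder_word Q q (coprod_word (fun l r => sgn K (dot (degw l) x.1) *: G l (x :: r))) d.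
  by rewrite -coder_wordD; apply: coder_word_eq => -[|z d'] // _ _ _; rewrite add0r.
rewrite !IH.
rewrite -[LHS]addrA; congr (_ + _).
  case: (d) => //; by rewrite add0r degw_nil dot0r sgn0 scale1r scaler0 !addr0.
rewrite !scalerDr -!coprod_wordZ -!coprod_wordD; apply: coprod_word_eq => l r _ _ _ _.
rewrite degw_cons dotDr dotDl /=.
have -> : coder_word Q q (fun l' => sgn K (dot (degw l') x.1) *: G l' (x :: r)) l =
    sgn K (dot Q x.1 + dot (degw l) x.1) *: coder_word Q q (fun l' => G l' (x :: r)) l.
  rewrite -coder_wordZ; apply: coder_word_eq => d' _ -> _.
  by rewrite dotDl.
rewrite coder_wordZ !scalerDr !scalerA -!sgnD.
rewrite [dot (degw l) Q]dotC [dot x.1 _]dotC !sgnD mulrA sgn_sqr mul1r dotDr sgnD.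
rewrite [sgn K (dot (degw l) x.1) * _]mulrC -[_ * sgn K (dot Q x.1)]mulrAC.
rewrite [sgn K (dot Q (degw l)) * sgn K (dot Q x.1)]mulrC !addrA.
by rewrite [RHS](ACl (1*6*2*4*5*7*3*8)).
Qed.

(** The unique summand of the coproduct whose right factor is a single letter
recovers the whole word; this is what makes the coproduct injective up to
letters. *)
Lemma coprod_word_last (H : word -> U) d :
  coprod_word (fun l r => if r is [:: y] then H (rcons l y) else 0) d =
  if d is [::] then 0 else H d.
Proof.
elim: d H => [|x d IH] H //=.
rewrite (IH (fun v => H (x :: v))) (_ : coprod_word _ d = 0).
  by case: d {IH} => [|y d]; rewrite ?addr0 // add0r.
rewrite -[RHS](coprod_word0 d); apply: coprod_word_eq => l [|y r] _ _ hs h //.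
  by move: h; rewrite -hs addn0 ltnn.
by rewrite scaler0.
Qed.

End Sums.

(** Projecting to a single letter keeps the term in which [q] eats the whole
word. *)
Lemma coder_word_corestr Q (q : word -> W) d :
  coder_word Q q (fun v => if v is [:: y] then y.2 else 0) d =
  if d is [::] then 0 else q d.
Proof.
elim: d Q q => [|x d IH] Q q //=.
rewrite coder_word0; last by case=> [|y []].
by rewrite scaler0 add0r IH; case: d {IH} => [|y d]; rewrite ?addr0 ?add0r.
Qed.

Section Maps.
Variables (U U' : lmodType K) (L : U -> U').
Hypothesis hL : linear L.

Lemma coder_word_map Q q F d : L (coder_word Q q F d) = coder_word Q q (fun v => L (F v)) d.
Proof.
have L0 := linear_0 hL.
elim: d Q q F => [|x d IH] Q q F //=.
rewrite -IH -IH -[F _ in LHS]scale1r hL scale1r hL.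
by [].
Qed.

Lemma coprod_word_map G d : L (coprod_word G d) = coprod_word (fun l r => L (G l r)) d.
Proof.
have L0 := linear_0 hL.
have LD u v : L (u + v) = L u + L v by rewrite -[u in LHS]scale1r hL scale1r.
have LZ c u : L (c *: u) = c *: L u by rewrite -[_ *: u]addr0 hL L0 addr0.
elim: d G => [|x d IH] G //=; rewrite !LD !IH; congr (_ + (_ + _)).
  by case: (d).
by apply: coprod_word_eq => l r _ _ _ _; rewrite LZ.
Qed.
End Maps.

(** * From sums over subsets of positions to the recursive sums *)

Section Subsets.
Variable (U : lmodType K).
Local Notation lft := (fintype.lift ord0).

Lemma enum_ordS_set m (I : {set 'I_m.+1}) : enum I =
  (if ord0 \in I then [:: ord0] else [::]) ++
  [seq lft i | i <- enum (lft @^-1: I)].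
Proof.
rewrite {1}/enum_mem -enumT enum_ordSl /= filter_map /enum_mem -enumT.
rewrite (eq_filter (a2 := mem (lft @^-1: I))); last by move=> i; rewrite !inE.
have hT (s : seq 'I_m) : [seq x <- s | mem 'I_m x] = s by apply/all_filterP/allP.
by rewrite hT; case: ifP.
Qed.

Lemma mem_lift0 m (I : {set 'I_m}) : (ord0 \in (lft @: I)%SET) = false.
Proof. by apply/negbTE/imsetP => -[i _ /eqP]; rewrite (negbTE (neq_lift _ _)). Qed.

Lemma mem_lift m (I : {set 'I_m}) i : (lft i \in (lft @: I)%SET) = (i \in I).
Proof. by rewrite mem_imset //; apply: fintype.lift_inj. Qed.

Lemma preim_lift0 m (I : {set 'I_m}) : (lft @^-1: (lft @: I) = I)%SET.
Proof. by apply/setP => i; rewrite inE mem_lift. Qed.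

Lemma preim_lift1 m (I : {set 'I_m}) : (lft @^-1: (ord0 |: lft @: I) = I)%SET.
Proof.
apply/setP => i; rewrite inE in_setU1 mem_lift.
by rewrite -[lft i == _]/false.
Qed.

Lemma sum_setS m (F : {set 'I_m.+1} -> U) : \sum_I F I =
  \sum_(I : {set 'I_m}) F (ord0 |: lft @: I)%SET +
  \sum_(I : {set 'I_m}) F (lft @: I)%SET.
Proof.
rewrite (bigID (fun I : {set 'I_m.+1} => ord0 \in I)) /=; congr (_ + _).
  rewrite (reindex_onto (fun I : {set 'I_m} => ord0 |: lft @: I)%SET
     (fun I : {set 'I_m.+1} => lft @^-1: I)%SET) /=.
    by apply: eq_bigl => I; rewrite setU11 preim_lift1 eqxx.
  move=> I I0; apply/setP => i; rewrite in_setU1.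
  case: (fintype.unliftP ord0 i) => [j ->|->]; last by rewrite eqxx I0.
  by rewrite mem_lift inE.
rewrite (reindex_onto (fun I : {set 'I_m} => lft @: I)%SET
  (fun I : {set 'I_m.+1} => lft @^-1: I)%SET) /=.
  by apply: eq_bigl => I; rewrite mem_lift0 preim_lift0 eqxx.
move=> I I0; apply/setP => i.
case: (fintype.unliftP ord0 i) => [j ->|->]; first by rewrite mem_lift inE.
by rewrite (negbTE I0) mem_lift0.
Qed.

Lemma subwordS1 m x (d : word) (I : {set 'I_m}) :
  subword (x :: d) (ord0 |: lft @: I)%SET = x :: subword d I.
Proof. by rewrite /subword enum_ordS_set setU11 /= -map_comp preim_lift1. Qed.

Lemma subwordS0 m x (d : word) (I : {set 'I_m}) :
  subword (x :: d) (lft @: I)%SET = subword d I.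
Proof. by rewrite /subword enum_ordS_set mem_lift0 -map_comp preim_lift0. Qed.

Lemma setC_lift1 m (I : {set 'I_m}) : (~: (ord0 |: lft @: I) = lft @: ~: I)%SET.
Proof.
apply/setP => i; rewrite finset.in_setC in_setU1.
case: (fintype.unliftP ord0 i) => [j ->|->]; last by rewrite eqxx !mem_lift0.
by rewrite !mem_lift finset.in_setC.
Qed.

Lemma setC_lift0 m (I : {set 'I_m}) : (~: (lft @: I) = ord0 |: lft @: ~: I)%SET.
Proof. by rewrite -[in LHS](finset.setCK I) -setC_lift1 finset.setCK. Qed.

Lemma koszulS1 m x (d : word) (I J : {set 'I_m}) :
  koszul (x :: d) (ord0 |: lft @: I)%SET (lft @: J)%SET = koszul d I J.
Proof.
rewrite /koszul big_setU1 /=; last by rewrite mem_lift0.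
rewrite big1 ?add0r; last by move=> i; rewrite ltn0 andbF.
rewrite big_imset /=; last by move=> ? ? _ _; apply: fintype.lift_inj.
apply: eq_bigr => i _; rewrite !big_mkcondr big_imset //=.
by move=> ? ? _ _; apply: fintype.lift_inj.
Qed.

Lemma dot_suml (I : Type) (r : seq I) (P : pred I) (f : I -> 'rV[int]_n) a :
  dot (\sum_(i <- r | P i) f i) a = \sum_(i <- r | P i) dot (f i) a.
Proof.
elim/big_ind2: _ => [|b c e g <- <-|//]; first exact: dot0l.
exact: dotDl.
Qed.

(** A first letter sent to the right factor jumps over the whole left factor. *)
Lemma koszulS0 m x (d : word) (I J : {set 'I_m}) :
  koszul (x :: d) (lft @: I)%SET (ord0 |: lft @: J)%SET =
  dot (degw (subword d I)) x.1 + koszul d I J.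
Proof.
rewrite /koszul big_imset /=; last by move=> ? ? _ _; apply: fintype.lift_inj.
rewrite /degw big_map big_enum dot_suml -big_split /=; apply: eq_bigr => i _.
rewrite !big_mkcondr big_setU1 /=; last by rewrite mem_lift0.
congr (_ + _); rewrite big_imset //=.
by move=> ? ? _ _; apply: fintype.lift_inj.
Qed.

(** The bridge with the definitions by sums over sets of positions; [m] may be
smaller than the length of [d], as the coproduct and the coderivations unshuffle
only an initial segment. *)
Lemma unshuffle_sum m G (d : word) : (m <= size d)%N ->
  \sum_(I : {set 'I_m}) sgn K (koszul d I (~: I)) *:
    G (subword d I) (subword d (~: I)) = unshuffle G (take m d) :> U.
Proof.
elim: m d G => [|m IH] d G.
  have e0 (I : {set 'I_0}) : enum I = [::].
    by apply: size0nil; rewrite -cardE; apply: eq_card0 => -[].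
  move=> _; rewrite (big_pred1 finset.set0) => [|I]; last by apply/esym/eqP/setP => -[].
  by rewrite /koszul /subword big_set0 scale1r !e0 take0.
case: d => // x d; rewrite ltnS => hm.
rewrite sum_setS /= -!IH //; congr (_ + _); apply: eq_bigr => I _.
  by rewrite setC_lift1 koszulS1 subwordS1 subwordS0.
by rewrite setC_lift0 koszulS0 subwordS1 subwordS0 sgnD scalerA mulrC.
Qed.
End Subsets.
End Words.

(** * Coproduct and coderivations of the tensor coalgebra *)

Section Linear.
Variables (K : fieldType) (U V : lmodType K) (f : U -> V).
Hypothesis hf : linear f.

Lemma linD u v : f (u + v) = f u + f v.
Proof. by rewrite -[u in LHS]scale1r hf scale1r. Qed.

Lemma linZ c u : f (c *: u) = c *: f u.
Proof. by rewrite -[_ *: u]addr0 hf (linear_0 hf) addr0. Qed.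

Lemma lin_sum (I : Type) (r : seq I) (P : pred I) (g : I -> U) :
  f (\sum_(i <- r | P i) g i) = \sum_(i <- r | P i) f (g i).
Proof. exact: (big_morph f linD (linear_0 hf)). Qed.
End Linear.

Section Bilinear.
Variables (K : fieldType) (U V : lmodType K).

Lemma opure_linl c x y (v : V) :
  opure (c *: x + y : U) v = c *: opure x v + opure y v.
Proof.
rewrite /opure /pgen -qpiZ -qpiD; apply: qpi_eq; apply: span_gen; left.
by exists c, x, y, v.
Qed.

Lemma opure_linr c (u : U) x y :
  opure u (c *: x + y : V) = c *: opure u x + opure u y.
Proof.
rewrite /opure /pgen -qpiZ -qpiD; apply: qpi_eq; apply: span_gen; right.
by exists c, u, x, y.
Qed.

Lemma bil_rel_lift (T : lmodType K) (f : U * V -> T) :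
  (forall v, linear (fun u => f (u, v))) -> (forall u, linear (fun v => f (u, v))) ->
  forall r, @bil_rel K U V r -> fglift f r = 0.
Proof.
move=> hl hr r [[c [x [y [v ->]]]]|[c [u [x [y ->]]]]];
  rewrite addrC -scaleN1r fglift_linear fglift_linear !liftU !scale1r ?hl ?hr;
  by rewrite scaleN1r addNr.
Qed.

Lemma otimes_eq (T : lmodType K) (f g : otimes U V -> T) : linear f -> linear g ->
  (forall u v, f (opure u v) = g (opure u v)) -> f =1 g.
Proof.
move=> hf hg h; elim/pres_ind => [|c [u v] t IH].
  by rewrite (linear_0 hf) (linear_0 hg).
by rewrite hf hg IH; congr (_ *: _ + _); apply: h.
Qed.
End Bilinear.

Section OtimesMap.
Variables (K : fieldType) (n : nat) (U : gradedSpace K n) (V U' V' : lmodType K).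
Implicit Types (Q : 'rV[int]_n) (f : U -> U') (g : V -> V').

Let omap Q f g (uv : U * V) := \sum_(a <- finsupp (dec uv.1))
  sgn K (dot Q a) *: opure (f (dec uv.1 a)) (g uv.2).

Lemma opure0l (v : V') : opure (0 : U') v = 0.
Proof.
exact: (linear_0 (f := fun u => opure u v)) (fun c x y => opure_linl c x y v).
Qed.

Let omap_rel Q f g : linear f -> linear g ->
  forall r, @bil_rel K U V r -> fglift (omap Q f g) r = 0.
Proof.
move=> hf hg; have f0 := linear_0 hf.
apply: bil_rel_lift => [v|u] c x y; rewrite /omap /=; last first.
  rewrite scaler_sumr -big_split; apply: eq_bigr => a _ /=.
  by rewrite hg opure_linr scalerDr !scalerA mulrC.
pose A := (finsupp (dec x) `|` finsupp (dec y) `|` finsupp (dec (c *: x + y)))%fset.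
have sub w : (finsupp (dec w) `<=` A)%fset ->
    \sum_(a <- finsupp (dec w)) sgn K (dot Q a) *: opure (f (dec w a)) (g v) =
    \sum_(a <- A) sgn K (dot Q a) *: opure (f (dec w a)) (g v).
  move=> sA; apply: big_fset_incl => // a _ /fsfun_dflt ->.
  by rewrite f0 opure0l scaler0.
rewrite !sub; try by apply/fsubsetP => b; rewrite !in_fsetU => ->; rewrite ?orbT.
rewrite scaler_sumr -big_split; apply: eq_bigr => a _ /=.
by rewrite dec_linear hf opure_linl scalerDr !scalerA mulrC.
Qed.

Lemma otimes_map_linear Q f g : linear f -> linear g -> linear (otimes_map Q f g).
Proof. by move=> hf hg; apply: plift_linear; apply: omap_rel. Qed.

(** The defining formula of f ⊗ g, which holds as such only for a homogeneous
first factor. *)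
Lemma otimes_map_opure Q f g a u v : linear f -> linear g -> gcomp a u ->
  otimes_map Q f g (opure u v) = sgn K (dot Q a) *: opure (f u) (g v).
Proof.
move=> hf hg hu; rewrite /otimes_map /opure (plift_gen _ (omap_rel Q hf hg)) /omap /=.
have hsub : (finsupp (dec u) `<=` [fset a])%fset.
  apply/fsubsetP => b; rewrite mem_finsupp (dec_hom b hu) in_fset1.
  by case: (b =P a) => //; rewrite eqxx.
rewrite (big_fset_incl _ hsub) => [|b _ /fsfun_dflt ->]; last first.
  by rewrite (linear_0 hf) opure0l scaler0.
by rewrite big_seq_fset1 (dec_hom _ hu) eqxx.
Qed.

Lemma otimes_hom_eq (T : lmodType K) (F G : otimes U V -> T) : linear F -> linear G ->
  (forall a u v, gcomp a u -> F (opure u v) = G (opure u v)) -> F =1 G.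
Proof.
move=> hF hG h; apply: otimes_eq => // u v.
have e (w : U) : opure w v = \sum_(a <- finsupp (dec w)) opure (dec w a) v.
  rewrite {1}(Defs.decP w).2 (lin_sum (f := fun u : U => opure u v)) // => c x y.
  exact: opure_linl.
rewrite e (lin_sum hF) (lin_sum hG); apply: eq_bigr => a _; apply: (h a).
exact: (Defs.decP u).1.
Qed.
End OtimesMap.

Section Tensor.
Variables (K : fieldType) (n : nat) (W : gradedSpace K n).
Local Notation word := (seq ('rV[int]_n * W)).
Local Notation TW := (tensG W).

Definition tensw (d : word) : TW := tens (letters d).

Lemma tensw_multilin : multilin tensw.
Proof. by move=> d1 d2 a c x y; rewrite /tensw /letters !map_cat /= tens_multi. Qed.

Lemma tensw_comp d : homw d -> gcomp (degw d) (tensw d).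
Proof. by move=> hd; apply: span_gen; exists d. Qed.

Lemma lin_tensw_multilin (U : lmodType K) (f : TW -> U) :
  linear f -> multilin (fun d => f (tensw d)).
Proof. by move=> hf d1 d2 a c x y; rewrite tensw_multilin hf. Qed.

(** T(W) is spanned by words of homogeneous letters, so these suffice to compare
linear maps. *)
Lemma tensw_lin_eq (U : lmodType K) (f g : TW -> U) : linear f -> linear g ->
  (forall d, homw d -> f (tensw d) = g (tensw d)) -> f =1 g.
Proof.
move=> hf hg h; elim/pres_ind => [|c s t IH].
  by rewrite (linear_0 hf) (linear_0 hg).
have -> : pgen (@tens_rel _ _ W) s = tens s by [].
rewrite hf hg IH tens_expand (lin_sum hf) (lin_sum hg); congr (_ *: _ + _).
  rewrite !big_seq; apply: eq_bigr => d /hexpand_hom hd; exact: h.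
Qed.

Let opurew (l r : word) : otimes TW TW := opure (tensw l) (tensw r).

Let opurew_multilin1 r : multilin (fun l => opurew l r).
Proof. by move=> d1 d2 a c x y; rewrite /opurew tensw_multilin opure_linl. Qed.
Let opurew_multilin2 l : multilin (opurew l).
Proof. by move=> d1 d2 a c x y; rewrite /opurew tensw_multilin opure_linr. Qed.

Let coprod_unshuffle : (fun d : word => \sum_(I : {set 'I_(size d).-1} | I != finset.set0)
    sgn K (koszul d I (~: I)) *:
    opure (tens (letters (subword d I)) : TW)
          (tens (rcons (letters (subword d (~: I))) (last (0, 0) d).2) : TW)) =
  coprod_word opurew.
Proof.
apply/funext; case/lastP => [|d x].
  by rewrite big1 // => I /negP[]; apply/eqP/setP => -[].
rewrite size_rcons /= last_rcons coprod_word_rcons.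
have e : take (size d) (rcons d x) = d by rewrite -cats1 take_size_cat.
rewrite -[X in unshuffle _ X]e -unshuffle_sum ?size_rcons // [RHS](bigD1 finset.set0) //=.
rewrite (_ : opurew (subword _ finset.set0) _ = 0); last first.
  by rewrite /opurew /subword enum_set0 /tensw tens_nil opure0l.
rewrite scaler0 add0r; apply: eq_bigr => I _.
by rewrite /opurew /tensw /letters map_rcons.
Qed.

Lemma coprod_linear : linear (@coprod K n W).
Proof.
rewrite /coprod coprod_unshuffle; apply: tlift_linear => //.
exact: coprod_word_multilin.
Qed.

Lemma coprod_tensw d : homw d -> coprod (tensw d) =
  coprod_word (fun l r => opure (tensw l : TW) (tensw r : TW)) d.
Proof.
move=> hd; rewrite /coprod coprod_unshuffle; apply: tlift_hom => //.
exact: coprod_word_multilin.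
Qed.

Section CoderOf.
Variables (Q : 'rV[int]_n) (q : TW -> W).
Hypothesis hq : linear q.

Let coder_unshuffle : (fun d : word => \sum_(k < size d) \sum_(I : {set 'I_k})
    sgn K (koszul d I (~: I) + dot Q (degw (subword d I))) *:
    tens (letters (subword d I) ++
          q (tens (rcons (letters (subword d (~: I))) (nth (0, 0) d k).2)) ::
          letters (drop k.+1 d))) = coder_word Q (fun r => q (tensw r)) tensw.
Proof.
apply/funext => d; rewrite coder_word_unshuffle; apply: eq_bigr => k _ /=.
rewrite -unshuffle_sum; last exact: ltnW.
apply: eq_bigr => I _; rewrite sgnD scalerA; congr (_ *: _).
by rewrite /tensw /letters !map_cat /= !map_rcons.
Qed.

Let coder_word_ml : multilin (coder_word Q (fun r => q (tensw r)) tensw).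
Proof. by apply: coder_word_multilin; [apply: lin_tensw_multilin | apply: tensw_multilin]. Qed.

Lemma coder_of_linear : linear (coder_of Q q).
Proof. by rewrite /coder_of coder_unshuffle; apply: tlift_linear. Qed.

Lemma coder_of_tensw d : homw d ->
  coder_of Q q (tensw d) = coder_word Q (fun r => q (tensw r)) tensw d.
Proof. by move=> hd; rewrite /coder_of coder_unshuffle; apply: tlift_hom. Qed.

Lemma linear_coder_of (U : lmodType K) (f : TW -> U) d : linear f -> homw d ->
  f (coder_of Q q (tensw d)) = coder_word Q (fun r => q (tensw r)) (fun v => f (tensw v)) d.
Proof. by move=> hf hd; rewrite coder_of_tensw // (coder_word_map hf). Qed.

Hypothesis qQ : has_weight Q q.

Lemma has_weight_word : word_weight Q (fun r => q (tensw r)).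
Proof. by move=> r hr; rewrite addrC; apply: qQ; apply: tensw_comp. Qed.

Lemma coder_of_weight : has_weight Q (coder_of Q q).
Proof.
move=> a t; elim=> [|c x u [d [hd <- ->]] _ IH].
  by rewrite (linear_0 coder_of_linear); apply: gcomp0.
rewrite coder_of_linear; apply: gcompL => //.
rewrite -[tens _]/(tensw d) coder_of_tensw //.
apply: (coder_word_sub (S := gcomp (degw d + Q))).
- exact: gcomp0.
- by move=> *; apply: gcompL.
- move=> d' h dd; rewrite addrC -dd; apply: tensw_comp; apply: h => //.
  exact: has_weight_word.
Qed.

(** On words of homogeneous letters this is [coprod_word_coder_word] for the map
sending a pair of words to its pure tensor. *)
Lemma coder_of_coder : is_coder Q (coder_of Q q).
Proof.
have lQ := coder_of_linear.
have lid (T : lmodType K) : linear (@idfun T) by [].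
split; [exact: lQ | exact: coder_of_weight |].
apply: tensw_lin_eq => [c x y|c x y|d hd].
- by rewrite lQ coprod_linear.
- rewrite coprod_linear !otimes_map_linear // scalerDr addrACA //.
- rewrite coprod_tensw // !(coprod_word_map (otimes_map_linear _ _ _)) //.
  rewrite linear_coder_of //; last exact: coprod_linear.
  rewrite (coder_word_eq (F' := coprod_word opurew)); last first.
    move=> d' h _ _; apply: coprod_tensw; apply: h => //; exact: has_weight_word.
  rewrite coprod_word_coder_word -coprod_wordD; apply: coprod_word_eq => l r h _ _ _.
  have [hl hr] := h hd; have tl := tensw_comp hl.
  rewrite !(otimes_map_opure _ _ _ _ tl) // dot0l scale1r !coder_of_tensw //.
  rewrite (coder_word_map (L := fun u => opure u (tensw r))); last first.
    by move=> c x y; apply: opure_linl.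
  by rewrite (coder_word_map (L := opure (tensw l))) // => c x y; apply: opure_linr.
Qed.
End CoderOf.
End Tensor.

(** * Corestrictions determine coderivations *)

Section LinearComb.
Variables (K : fieldType) (U V T : lmodType K).

Lemma lin_comp (f : V -> T) (g : U -> V) : linear f -> linear g ->
  linear (fun u => f (g u)).
Proof. by move=> hf hg c x y; rewrite hg hf. Qed.

Lemma lin_comb c (f g : U -> V) : linear f -> linear g ->
  linear (fun u => f u + c *: g u).
Proof.
move=> hf hg b x y; rewrite hf hg !scalerDr !scalerA [c * b]mulrC.
exact: addrACA.
Qed.
End LinearComb.

Section Uniqueness.
Variables (K : fieldType) (n : nat) (W : gradedSpace K n).
Local Notation word := (seq ('rV[int]_n * W)).
Local Notation TW := (tensG W).

Let hd1 : seq W -> W := fun s => if s is [:: w] then w else 0.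

Let hd1_rel : forall r, @tens_rel _ _ W r -> fglift hd1 r = 0.
Proof.
apply: tens_rel_lift => // -[|z [|y s1]] [|y' s2] c u v //=; by rewrite scaler0 addr0.
Qed.

Lemma tproj1_linear : linear (@tproj1 K n W).
Proof. exact: plift_linear hd1_rel. Qed.

Lemma tproj1_tens s : tproj1 (tens s : TW) = if s is [:: w] then w else 0.
Proof. exact: (plift_gen _ hd1_rel). Qed.

Lemma tproj1_tensw (d : word) : tproj1 (tensw d) = if d is [:: y] then y.2 else 0.
Proof. by rewrite /tensw tproj1_tens; case: d => [|y []]. Qed.

Lemma tproj1_comp a (t : TW) : gcomp a t -> gcomp a (tproj1 t).
Proof.
elim=> [|c x u [d [hd <- ->]] _ IH]; first by rewrite (linear_0 tproj1_linear); apply: gcomp0.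
rewrite tproj1_linear; apply: gcompL => //; rewrite -[tens _]/(tensw d) tproj1_tensw.
case: d hd {IH} => [|y [|z d]] hd; try exact: gcomp0.
by rewrite degw_cons degw_nil addr0; apply: hd; rewrite mem_head.
Qed.

Lemma corestr_coder_of Q (q : TW -> W) : linear q -> corestr (coder_of Q q) =1 q.
Proof.
move=> hq; apply: tensw_lin_eq => // [|d hd].
  by apply: (lin_comp tproj1_linear); apply: coder_of_linear.
rewrite /corestr linear_coder_of //; last exact: tproj1_linear.
transitivity (coder_word Q (fun r => q (tensw r)) (fun v => if v is [:: y] then y.2 else 0) d).
  by apply: coder_word_eq => d' _ _ _; rewrite tproj1_tensw.
rewrite coder_word_corestr; case: d {hd} => //.
by rewrite /tensw tens_nil (linear_0 hq).
Qed.

(** On the empty word the value is 0 and not the letter [w], since the empty word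
is zero in T(W). *)
Let snocf (w : W) (s : seq W) : TW := if s is [::] then 0 else tens (rcons s w).

Let snoc_rel w : forall r, @tens_rel _ _ W r -> fglift (snocf w) r = 0.
Proof.
apply: tens_rel_lift => // s1 s2 c x y.
have e (z : W) : snocf w (s1 ++ z :: s2) = tens (s1 ++ z :: rcons s2 w).
  by rewrite -rcons_cons -rcons_cat; case: (s1).
by rewrite !e tens_multi.
Qed.

Let snoc (w : W) : TW -> TW := plift (snocf w).

Let snoc_linear w : linear (snoc w).
Proof. exact: plift_linear (@snoc_rel w). Qed.

Let snoc_tensw w (d : word) : snoc w (tensw d) =
  if d is [::] then 0 else tens (rcons (letters d) w).
Proof. by rewrite /snoc (plift_gen _ (@snoc_rel w)); case: d. Qed.

Let snoc_linearl t : linear (fun w => snoc w t).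
Proof.
move=> c x y; rewrite [RHS]addrC; move: t; apply: tensw_lin_eq => [||d _].
- exact: snoc_linear.
- by apply: lin_comb; apply: snoc_linear.
- rewrite !snoc_tensw addrC; case: d => [|z d]; first by rewrite scaler0 addr0.
  by rewrite -!cats1 tens_multi.
Qed.

Let join : otimes TW TW -> TW := plift (fun uv => snoc (tproj1 uv.2) uv.1).

Let join_rel : forall r, @bil_rel K TW TW r ->
  fglift (fun uv => snoc (tproj1 uv.2) uv.1) r = 0.
Proof.
apply: bil_rel_lift => [v|u] c x y /=; first exact: snoc_linear.
by rewrite tproj1_linear snoc_linearl.
Qed.

Let join_linear : linear join.
Proof. exact: plift_linear join_rel. Qed.

Let join_opure u v : join (opure u v) = snoc (tproj1 v) u.
Proof. exact: (plift_gen _ join_rel). Qed.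

Let tens1_linear : linear (fun w : W => tens [:: w] : TW).
Proof. by move=> c x y; apply: (tens_multi [::]). Qed.

(** Up to its component of length 1, a tensor is recovered from its coproduct.
The factor 1 gives the right side the shape of [lin_comb], which then yields its
linearity. *)
Let coprod_join t : t = tens [:: tproj1 t] + 1 *: join (coprod t).
Proof.
move: t; apply: tensw_lin_eq => [//||d hd].
  apply: lin_comb; first by apply: (lin_comp tens1_linear); apply: tproj1_linear.
  by apply: lin_comp => //; apply: coprod_linear.
rewrite scale1r coprod_tensw // (coprod_word_map join_linear).
pose H (v : word) : TW := if v is [:: _] then 0 else tensw v.
transitivity (tens [:: tproj1 (tensw d)] +
  coprod_word (fun l r => if r is [:: y] then H (rcons l y) else 0) d); last first.
  congr (_ + _); apply: coprod_word_eq => l r _ _ _ _; rewrite join_opure tproj1_tensw.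
  case: r => [|y [|z r]]; try by rewrite (linear_0 (snoc_linearl _)).
  rewrite snoc_tensw /H; case: l => //= x l; case: l => //= z l.
  by rewrite /tensw /letters /= map_rcons.
have t0 := linear_0 tens1_linear.
rewrite coprod_word_last tproj1_tensw /H; case: d {hd} => [|x [|y d]] //=.
- by rewrite t0 addr0 /tensw tens_nil.
- by rewrite addr0.
- by rewrite t0 add0r.
Qed.

(** By induction on the length of words: the coproduct of R(w) is computed from
the values of R on shorter words, and the component of R(w) of length 1, which
the coproduct does not see, is the corestriction. *)
Lemma coder_eq Q R R' : is_coder Q R -> is_coder Q R' ->
  (forall t : TW, corestr R t = corestr R' t) -> R = R'.
Proof.
move=> [lR _ cR] [lR' _ cR'] h; apply/funext; apply: tensw_lin_eq => // d.
have [m] := ubnP (size d); elim: m d => // m IH d sd hd.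
rewrite (coprod_join (R _)) (coprod_join (R' _)) -[tproj1 (R _)]/(corestr _ _) h.
congr (_ + _ *: join _); rewrite cR cR' coprod_tensw //.
rewrite !(coprod_word_map (otimes_map_linear _ _ _)) //; congr (_ + _);
  apply: coprod_word_eq => l r hlr _ s1 s2; have [hl hr] := hlr hd;
  have tl := tensw_comp hl; rewrite !(otimes_map_opure _ _ _ _ tl) //.
  by rewrite IH //; apply: leq_trans s2 _.
have [->|l0] := eqVneq l [::]; first by rewrite /tensw tens_nil !opure0l.
rewrite IH //; apply: (leq_trans _ (sd : (size d <= m)%N)).
by rewrite -s1 -add1n leq_add2r lt0n size_eq0.
Qed.

(** In the commutator the mixed terms R(-) ⊗ R'(-) cancel, since moving R past R'
costs exactly the sign (-1)^<Q,Q'>. *)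
Lemma commutator_coder Q Q' R R' : is_coder Q R -> is_coder Q' R' ->
  is_coder (Q + Q') (fun t : TW => R (R' t) - sgn K (dot Q Q') *: R' (R t)).
Proof.
move=> [lR wR cR] [lR' wR' cR'].
set C := fun t => _.
have CE t : C t = R (R' t) + (- sgn K (dot Q Q')) *: R' (R t) by rewrite scaleNr.
have lC : linear C.
  move=> c x y; rewrite !CE.
  exact: (lin_comb (- sgn K (dot Q Q')) (lin_comp lR lR') (lin_comp lR' lR)).
split=> //.
  move=> a t ht; rewrite CE [R _ + _]addrC; apply: gcompL; last first.
    by rewrite addrA addrAC; apply: wR; apply: wR'.
  by rewrite addrA; apply: wR'; apply: wR.
(* P Q1 R1 is R1 ⊗ id + id ⊗ R1, in the shape of [lin_comb]. *)
pose P Q1 (R1 : TW -> TW) := fun u : otimes TW TW =>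
  otimes_map (0 : 'rV[int]_n) R1 id u + 1 *: otimes_map Q1 id R1 u.
have lid (T : lmodType K) : linear (@idfun T) by [].
have lP Q1 R1 : linear R1 -> linear (P Q1 R1).
  by move=> l1; apply: lin_comb; apply: otimes_map_linear.
have PE Q1 R1 a u v : linear R1 -> gcomp a u -> P Q1 R1 (opure u v) =
    opure (R1 u) v + sgn K (dot Q1 a) *: opure u (R1 v).
  by move=> l1 ha; rewrite /P !(otimes_map_opure _ _ _ _ ha) // dot0l !scale1r.
have cP Q1 R1 : (forall t : TW, coprod (R1 t) =
        otimes_map (0 : 'rV[int]_n) R1 id (coprod t) + otimes_map Q1 id R1 (coprod t)) ->
    forall t, coprod (R1 t) = P Q1 R1 (coprod t).
  by move=> h t; rewrite h /P scale1r.
have key u : P Q R (P Q' R' u) + (- sgn K (dot Q Q')) *: P Q' R' (P Q R u) = P (Q + Q') C u.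
  move: u; apply: otimes_hom_eq => [||a u v ha].
  - by apply: lin_comb; apply: lin_comp; apply: lP.
  - exact: lP.
  have ha1 := wR _ _ ha; have ha2 := wR' _ _ ha.
  rewrite !(PE _ _ _ _ _ _ ha) // !(linD (lP _ _ _)) // !(linZ (lP _ _ _)) //.
  rewrite !(PE _ _ _ _ _ _ ha) // (PE _ _ _ _ _ _ ha1) // (PE _ _ _ _ _ _ ha2) //.
  have El : opure (C u) v = opure (R (R' u)) v + - sgn K (dot Q Q') *: opure (R' (R u)) v.
    by rewrite CE addrC opure_linl addrC.
  have Er : opure u (C v) = opure u (R (R' v)) + - sgn K (dot Q Q') *: opure u (R' (R v)).
    by rewrite CE addrC opure_linr addrC.
  rewrite El Er !dotDr !dotDl !sgnD [dot Q' Q]dotC !scalerDr !scalerA.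
  set s := sgn K (dot Q Q'); set b := sgn K (dot Q a); set b' := sgn K (dot Q' a).
  have ss : s * s = 1 by apply: sgn_sqr.
  have e1 : - s * (b' * s) = - b' by rewrite mulNr mulrCA ss mulr1.
  rewrite e1 !addrA [LHS](ACl ((1*5)*(4*8)*((2*7)*(3*6)))) /= -!scalerDl.
  rewrite mulNr [s * b]mulrC !subrr !scale0r !addr0 [b' * b]mulrC.
  by rewrite mulNr mulrN mulrAC addrA.
move=> t; rewrite -[RHS]/(otimes_map (0 : 'rV[int]_n) C id (coprod t) + _).
rewrite -[X in _ + X]scale1r -[RHS]/(P _ _ _) -key CE -!cP //.
by rewrite addrC coprod_linear addrC.
Qed.
End Uniqueness.

(** * Multilinear maps and coderivations with one corestriction *)

Section Phi.
Variables (K : fieldType) (n : nat) (V : gradedSpace K n.+1).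
Local Notation W := (desusp V).
Local Notation TW := (tensG W).
Local Notation vword := (seq ('rV[int]_n.+1 * V)).
Local Notation wword := (seq ('rV[int]_n.+1 * W)).
Local Notation e1 := (e1 n).

Definition desuspw (d : vword) : wword := [seq (x.1 - e1, x.2) | x <- d].
Definition suspw (d : wword) : vword := [seq (x.1 + e1, x.2) | x <- d].

Lemma desuspwK d : desuspw (suspw d) = d.
Proof.
by rewrite /desuspw /suspw -map_comp map_id_in // => -[a x] _ /=; rewrite addrK.
Qed.

Lemma letters_desuspw d : letters (desuspw d) = letters d :> seq V.
Proof. by rewrite /letters /desuspw -map_comp. Qed.

Lemma letters_suspw d : letters (suspw d) = letters d :> seq V.
Proof. by rewrite /letters /suspw -map_comp. Qed.

Lemma homw_desuspw d : homw d -> homw (desuspw d).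
Proof. by move=> hd _ /mapP[x xd ->]; rewrite /= /dcomp subrK; apply: hd. Qed.

Lemma homw_suspw d : homw d -> homw (suspw d).
Proof. by move=> hd _ /mapP[x xd ->]; apply: (hd x). Qed.

Lemma degw_suspw d : degw (suspw d) = degw d + e1 *+ size d.
Proof.
elim: d => [|x d IH] /=; first by rewrite !degw_nil addr0.
by rewrite !degw_cons IH mulrS addrACA.
Qed.

Lemma degw_desuspw d : degw (desuspw d) = degw d - e1 *+ size d.
Proof.
elim: d => [|x d IH] /=; first by rewrite !degw_nil subr0.
by rewrite !degw_cons IH mulrS opprD addrACA.
Qed.

Lemma up_exp_cat d1 d2 a (x y : W) :
  up_exp (d1 ++ (a, x) :: d2) = up_exp (d1 ++ (a, y) :: d2).
Proof. by elim: d1 => [|z d1 IH] //=; rewrite IH !size_cat. Qed.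

Let upf (d : wword) : tensG V := sgn K (up_exp d) *: tens [seq up v | v <- letters d].

Let upf_nil : upf [::] = 0.
Proof. by rewrite /upf tens_nil scaler0. Qed.

Let upf_multilin : multilin upf.
Proof.
move=> d1 d2 a c x y; rewrite /upf (up_exp_cat _ _ _ _ x) (up_exp_cat _ _ _ y x).
by rewrite /letters !map_cat /= [up _]/(c *: up x + up y) tens_multi scalerDr !scalerA mulrC.
Qed.

Lemma up_tens_linear : linear (@up_tens K n V).
Proof. exact: tlift_linear. Qed.

Lemma up_tens_tensw (d : wword) : homw d ->
  up_tens (tensw d) = sgn K (up_exp d) *: tens (letters d : seq V).
Proof.
move=> hd; rewrite /up_tens tlift_hom //; congr (_ *: tens _).
exact: map_id.
Qed.

Section Mext.
Variables (p : nat) (m : seq V -> V).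
Hypothesis hm : is_plinear p.+1 m.

Let m_rel : forall r, @tens_rel _ _ V r -> fglift m r = 0.
Proof.
case: hm => m0 mD; apply: tens_rel_lift => [|s1 s2 c x y]; first exact: m0.
have [sp|sp] := eqVneq (size s1 + size s2).+1 p.+1; first exact: mD.
by rewrite !m0 ?scaler0 ?addr0 // size_cat /= addnS.
Qed.

Lemma mext_linear : linear (mext m).
Proof. exact: plift_linear m_rel. Qed.

Lemma mext_tens s : mext m (tens s) = m s.
Proof. exact: (plift_gen _ m_rel). Qed.
End Mext.

Definition phi_corestr (a : nat) (m : seq V -> V) : TW -> W :=
  fun t => (-1) ^+ (a * a.+1)./2 *: Defs.down (mext m (up_tens t)).

Section OnMcomp.
Variables (A : 'rV[int]_n.+1) (a : nat) (m : seq V -> V).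
Hypothesis hm : Mcomp A a m.

Lemma phi_corestr_linear : linear (phi_corestr a m).
Proof.
move=> c x y; rewrite /phi_corestr up_tens_linear (mext_linear hm.1).
by rewrite [LHS]scalerDr !scalerA mulrC.
Qed.

Lemma phi_corestr_tensw (d : wword) : homw d -> phi_corestr a m (tensw d) =
  (-1) ^+ (a * a.+1)./2 *: (sgn K (up_exp d) *: (m (letters d) : W)).
Proof.
move=> hd; rewrite /phi_corestr up_tens_tensw // (linZ (mext_linear hm.1)).
by rewrite (mext_tens hm.1).
Qed.

Lemma phi_corestr_size s : size s != a.+1 -> phi_corestr a m (tens s) = 0.
Proof.
move=> hs; rewrite tens_expand (lin_sum phi_corestr_linear) big_seq big1 // => d hd.
rewrite -[tens _]/(tensw d) phi_corestr_tensw; last exact: hexpand_hom hd.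
by rewrite hm.1.1 ?scaler0 // size_map (size_hexpand hd).
Qed.

Lemma phi_corestr_weight : has_weight (A + e1 *+ a) (phi_corestr a m).
Proof.
move=> b t; elim=> [|c x u [d [hd <- ->]] _ IH].
  by rewrite (linear_0 phi_corestr_linear); apply: gcomp0.
rewrite phi_corestr_linear; apply: gcompL => //.
have [sd|sd] := eqVneq (size d) a.+1; last first.
  by rewrite phi_corestr_size ?size_map //; apply: gcomp0.
rewrite -[tens _]/(tensw d) phi_corestr_tensw //; apply: gcompZ; apply: gcompZ.
have := hm.2 (suspw d) (homw_suspw hd).
rewrite size_map letters_suspw degw_suspw sd => /(_ erefl).
rewrite /= /dcomp mulrSr; congr gcomp.
by rewrite addrCA !addrA.
Qed.

Lemma phi_coder : CoDer (A + e1 *+ a) a.+1 (phi V A a m).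
Proof.
split; first exact: coder_of_coder phi_corestr_linear phi_corestr_weight.
move=> s hs; rewrite (corestr_coder_of _ phi_corestr_linear).
exact: phi_corestr_size.
Qed.

Lemma corestr_phi : corestr (phi V A a m) =1 phi_corestr a m.
Proof. exact: corestr_coder_of phi_corestr_linear. Qed.
End OnMcomp.

Lemma sgn_scalerI z (x y : W) : sgn K z *: x = sgn K z *: y -> x = y.
Proof. by move=> h; rewrite -[x]scale1r -(sgn_sqr K z) -scalerA h scalerA sgn_sqr scale1r. Qed.

(** The corestriction of [phi V A a m] is [m] up to a sign that depends only on
degrees, and words of homogeneous letters determine [m]. *)
Lemma phi_inj A a m m' : Mcomp A a m -> Mcomp A a m' ->
  phi V A a m = phi V A a m' -> m = m'.
Proof.
move=> hm hm' h; apply/funext => s.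
have [sp|sp] := eqVneq (size s) a.+1; last by rewrite hm.1.1 // hm'.1.1.
have hom k : Mcomp A a k -> homsum (fun d => k (letters d)) s = k s.
  move=> hk; apply: homsum_letters => s1 s2 c x y hs; apply: hk.1.2.
  by rewrite -sp -hs size_cat /= addnS.
rewrite -(hom _ hm) -(hom _ hm') /homsum !big_seq; apply: eq_bigr => d hd.
have hd' := homw_desuspw (hexpand_hom hd).
have := corestr_phi hm (tensw (desuspw d)).
rewrite h (corestr_phi hm') (phi_corestr_tensw hm) // (phi_corestr_tensw hm') //.
rewrite letters_desuspw => /(scalerI _) h1; apply/esym/(@sgn_scalerI (up_exp (desuspw d))).
by apply: h1; rewrite signr_eq0.
Qed.

(** The map [m] is the corestriction of [R] with the sign of the tensor power of
the suspension undone on homogeneous letters; [coder_eq] then identifies [R]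
with the image of [m]. *)
Lemma phi_surj A a R : CoDer (A + e1 *+ a) a.+1 R ->
  exists m, Mcomp A a m /\ phi V A a m = R.
Proof.
move=> [cR sR]; have [lR wR _] := cR.
have lq : linear (corestr R) by apply: (lin_comp (@tproj1_linear _ _ _)).
pose G (d : vword) : V := sgn K (up_exp (desuspw d)) *: corestr R (tens (letters d : seq W)).
have hG : multilin G.
  move=> d1 d2 b c x y; rewrite /G /desuspw !map_cat /=.
  rewrite (up_exp_cat _ _ _ _ x) (up_exp_cat _ _ _ y x) /letters !map_cat /=.
  rewrite (tens_multi (W := W)) lq.
  by rewrite [LHS]scalerDr !scalerA mulrC.
pose m s : V := if size s == a.+1 then (-1) ^+ (a * a.+1)./2 *: homsum G s else 0.
have mG d : homw d -> size d = a.+1 -> m (letters d) = (-1) ^+ (a * a.+1)./2 *: G d.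
  by move=> hd sd; rewrite /m size_map sd eqxx homsum_hom.
have hm : Mcomp A a m.
  split; first split.
  - by move=> s /negbTE hs; rewrite /m hs.
  - move=> s1 s2 c x y hs; rewrite /m !size_cat /= !addnS hs eqxx homsum_multi //.
    by rewrite scalerDr !scalerA mulrC.
  - move=> d hd sd; rewrite mG //; apply: gcompZ; apply: gcompZ.
    have := tproj1_comp (wR _ _ (tensw_comp (homw_desuspw hd))).
    rewrite /tensw letters_desuspw degw_desuspw sd /= /dcomp; congr gcomp.
    by rewrite mulrSr -[LHS]addrA -[A + _ + _]addrA addrCA subrK.
exists m; split=> //; apply: (coder_eq (phi_coder hm).1 cR) => t; rewrite (corestr_phi hm).
move: t; apply: tensw_lin_eq => [|//|d hd]; first exact: phi_corestr_linear hm.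
have [sd|sd] := eqVneq (size d) a.+1; last first.
  by rewrite (phi_corestr_size hm) ?size_map // sR ?size_map.
rewrite (phi_corestr_tensw hm) // -letters_suspw mG; last 2 first.
- exact: homw_suspw.
- by rewrite size_map.
rewrite /G desuspwK letters_suspw [X in _ *: X]scalerA [LHS]scalerA.
by rewrite [LHS]scalerA mulrCA -expr2 sqrr_sign mulr1 sgn_sqr scale1r.
Qed.

Lemma Mcomp0 A a : Mcomp A a (0 : seq V -> V).
Proof. exact: (Mcomp_sub V A a).1. Qed.

Lemma phi0 A a : phi V A a 0 = fun=> 0.
Proof.
have hm := Mcomp0 A a; have lq := phi_corestr_linear hm.
have q0 t : phi_corestr a 0 t = 0.
  move: t; apply: (tensw_lin_eq lq) => [c x y|d hd]; first by rewrite scaler0 addr0.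
  by rewrite (phi_corestr_tensw hm) // !scaler0.
apply/funext; apply: tensw_lin_eq => [||d hd].
- by have [[]] := phi_coder hm.
- by move=> c x y; rewrite scaler0 addr0.
- rewrite -[phi _ _ _ _]/(coder_of (A + e1 *+ a) (phi_corestr a 0)) coder_of_tensw //.
  by apply: coder_word_eq0 => [|r d' _]; [apply: tensw_multilin | left].
Qed.

Lemma dot_e1 : dot e1 e1 = 1.
Proof.
rewrite /dot (bigD1 ord0) //= big1 => [|i /negbTE i0]; first by rewrite mxE !eqxx mulr1 addr0.
by rewrite mxE i0 andbF mul0r.
Qed.

Lemma sgn1 : sgn K 1 = -1.
Proof. by rewrite /sgn expr1z. Qed.

(** * The square of the coderivation of a binary bracket *)

Section Binary.
Variable m : seq V -> V.
Hypothesis hm : Mcomp 0 1 m.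
Local Notation E := (0 + e1 *+ 1).
Local Notation R := (phi V 0 1 m).
Let qw (d : wword) : W := phi_corestr 1 m (tensw d).

Let qw2 x y : homw [:: x; y] -> qw [:: x; y] = - (sgn K (dot e1 x.1) *: (m [:: x.2; y.2] : W)).
Proof.
move=> h; rewrite /qw (phi_corestr_tensw hm) // /= dot0l !addr0 mulr1n.
by rewrite expr1 scaleN1r.
Qed.

Let qw0 d : size d != 2 -> qw d = 0.
Proof. by move=> hd; rewrite /qw (phi_corestr_size hm) ?size_map. Qed.

Let qw_multilin : multilin qw.
Proof. exact: lin_tensw_multilin (phi_corestr_linear hm). Qed.

Lemma corestr_phi_sqr (d : wword) : homw d -> size d != 3 -> corestr R (R (tensw d)) = 0.
Proof.
move=> hd sd; have lq := phi_corestr_linear hm.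
rewrite (corestr_phi hm) linear_coder_of //.
apply: coder_word_eq0 => [|r d' hs]; first exact: qw_multilin.
have [sr|sr] := eqVneq (size r) 2; last by left; apply: qw0.
right; apply: qw0; apply: contraNneq sd => sd'.
by move: hs; rewrite sr sd' => -[<-].
Qed.

(** Among the terms of R applied twice to three letters, only three survive,
according to the two letters on which the inner [q] acts: (y,z), (x,y) or (x,z).
These are the three terms of the Loday identity, and their signs, once the
degrees are shifted by [e1], agree up to the common factor (-1)^<e1,y>. *)
Lemma corestr_phi_sqr3 x y z : homw [:: x; y; z] ->
  corestr R (R (tensw [:: x; y; z])) =
  sgn K (dot e1 y.1) *: (m [:: x.2; m [:: y.2; z.2]] - m [:: m [:: x.2; y.2]; z.2] -
    sgn K (dot (x.1 + e1) (y.1 + e1)) *: m [:: y.2; m [:: x.2; z.2]] : W).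
Proof.
move=> /[dup] h /homw_cons[hx /homw_cons[hy /homw_cons[hz _]]].
have lq := phi_corestr_linear hm; have wq := has_weight_word (phi_corestr_weight hm).
have h2 (u v : 'rV[int]_n.+1 * W) : gcomp u.1 u.2 -> gcomp v.1 v.2 -> homw [:: u; v].
  by move=> hu hv; apply/homw_cons; split=> //; apply/homw_cons; split.
have EE : E = e1 by rewrite add0r.
have wq2 u v : homw [:: u; v] -> gcomp (e1 + u.1 + v.1) (qw [:: u; v]).
  by move=> /wq; rewrite EE !degw_cons degw_nil addr0 addrA.
have mZl c u v : m [:: c *: u; v] = c *: m [:: u; v].
  have := hm.1.2 [::] [:: v] c u 0 erefl; rewrite addr0 => ->.
  by have := hm.1.2 [::] [:: v] 1 0 0 erefl; rewrite !scale1r addr0 => /eqP;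
     rewrite eq_sym -subr_eq0 addrK => /eqP /= ->; rewrite addr0.
have mZr c u v : m [:: u; c *: v] = c *: m [:: u; v].
  have := hm.1.2 [:: u] [::] c v 0 erefl; rewrite addr0 => ->.
  by have := hm.1.2 [:: u] [::] 1 0 0 erefl; rewrite !scale1r addr0 => /eqP;
     rewrite eq_sym -subr_eq0 addrK => /eqP /= ->; rewrite addr0.
rewrite (corestr_phi hm) linear_coder_of // -/qw EE [LHS]/= !scaler0 !addr0.
(* Since [q] takes two letters, the outer [q] vanishes on three letters or one. *)
rewrite !(qw0 (d := [:: _; _; _])) // !scaler0 !(addr0, add0r).
have hxy := h2 _ _ hx hy; have hyz := h2 _ _ hy hz; have hxz := h2 _ _ hx hz.
rewrite !(qw0 (d := [:: _])) // !addr0.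
have hl u v w : homw [:: u; v] -> gcomp w.1 w.2 ->
    qw [:: (e1 + u.1 + v.1, qw [:: u; v]); w] =
    (- sgn K (dot e1 v.1)) *: (m [:: m [:: u.2; v.2]; w.2] : W).
  move=> huv hw; rewrite [LHS]qw2; last by apply: h2 => //; apply: wq2.
  rewrite [qw _]qw2 // -!scaleNr /= mZl [LHS]scalerA; congr (_ *: _).
  by rewrite !dotDr !sgnD dot_e1 sgn1 mulrNN mulN1r !mulNr mulrAC sgn_sqr mul1r.
have hr u v w : gcomp u.1 u.2 -> homw [:: v; w] ->
    qw [:: u; (e1 + v.1 + w.1, qw [:: v; w])] =
    (sgn K (dot e1 u.1) * sgn K (dot e1 v.1)) *: (m [:: u.2; m [:: v.2; w.2]] : W).
  move=> hu hvw; rewrite [LHS]qw2; last by apply: h2 => //; apply: wq2.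
  by rewrite [qw _]qw2 // -!scaleNr /= mZr [LHS]scalerA mulrNN.
rewrite hl // !hr // !scalerBr [X in X + _]scalerA.
rewrite [X in _ + (_ + X)]scalerA [X in _ = _ - X]scalerA mulrA sgn_sqr mul1r.
rewrite -[RHS]addrA; congr (_ + (_ + _)); first exact: scaleNr.
rewrite -[RHS]scaleNr; congr (_ *: _).
rewrite !dotDr !dotDl !sgnD dot_e1 sgn1 [dot x.1 e1]dotC.
by rewrite mulrN1 !mulrN opprK !mulrA.
Qed.

Lemma gcommE t : gcomm E E R R t = R (R t) + R (R t).
Proof. by rewrite /gcomm add0r dot_e1 sgn1 scaleN1r opprK. Qed.

(** This is what puts the commutator in the image of [phi], so that [phi_inv] is
an actual preimage of it. *)
Lemma gcomm_CoDer : CoDer (0 + 0 + e1 *+ 2) 3 (gcomm E E R R).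
Proof.
have [cR _] := phi_coder hm; have [lR _ _] := cR.
split; first by have := commutator_coder cR cR; rewrite mulr2n !add0r.
move=> s hs; have lC : linear (fun t => corestr R (R t)).
  exact: (lin_comp (lin_comp (@tproj1_linear _ _ _) lR) lR).
rewrite /corestr gcommE (linD (@tproj1_linear _ _ _)).
rewrite -[tproj1 _]/(corestr R (R (tens s))) tens_expand (lin_sum lC) big_seq big1 ?addr0 //.
move=> d hd; apply: corestr_phi_sqr; first exact: hexpand_hom hd.
by rewrite (size_hexpand hd).
Qed.

Hypothesis charK : [pchar K] =i pred0.

Lemma gcomm_eq0 : (gcomm E E R R = fun=> 0) <-> forall t, R (R t) = 0.
Proof.
split=> [h t|h]; last by apply/funext => t; rewrite gcommE h addr0.
have := congr1 (@^~ t) h; rewrite /= gcommE -mulr2n -scaler_nat => /eqP.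
by rewrite scaler_eq0 => /orP[|/eqP//]; rewrite (GRing.pcharf0P _).1.
Qed.

(** If the Loday identity holds, all corestrictions of the commutator vanish, and
so does the commutator by [coder_eq]. *)
Lemma loday_codifferential : Lod V m <-> forall t, R (R t) = 0.
Proof.
split=> [[_ hL]|h]; last first.
  split=> // al be ga a b c ha hb hc.
  pose d : wword := desuspw [:: (al, a); (be, b); (ga, c)].
  have hd : homw d.
    by apply: homw_desuspw; do 3!(apply/homw_cons; split=> //).
  have := corestr_phi_sqr3 hd; rewrite /corestr h (linear_0 (@tproj1_linear _ _ _)) /=.
  rewrite -[0](scaler0 _ (sgn K (dot e1 (be - e1)))) => /sgn_scalerI /eqP.
  by rewrite !subrK eq_sym -addrA -opprD subr_eq0 => /eqP.
apply/gcomm_eq0.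
have C0 : corestr (gcomm E E R R) =1 fun=> 0.
  apply: tensw_lin_eq => [|c x y|d hd].
  - by apply: (lin_comp (@tproj1_linear _ _ _)); have [[]] := gcomm_CoDer.
  - by rewrite scaler0 addr0.
  have [sd|sd] := eqVneq (size d) 3; last by rewrite gcomm_CoDer.2 ?size_map.
  rewrite /corestr gcommE (linD (@tproj1_linear _ _ _)) -[tproj1 _]/(corestr R (R _)).
  case: d sd hd => [|x [|y [|z [|]]]] // _ hd; rewrite corestr_phi_sqr3 //.
  have := hd => /homw_cons[hx /homw_cons[hy /homw_cons[hz _]]].
  rewrite (hL _ _ _ _ _ _ hx hy hz) [m [:: m _; _] + _]addrC addrK subrr scaler0.
  exact: addr0.
have cz : is_coder (0 + 0 + e1 *+ 2) (fun _ : TW => 0).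
  by rewrite -(phi0 (0 + 0) 2); have [] := phi_coder (Mcomp0 (0 + 0) 2).
apply: (coder_eq gcomm_CoDer.1 cz) => t.
by rewrite C0 /corestr (linear_0 (@tproj1_linear _ _ _)).
Qed.

Lemma stem_eq0 : stem 0 1 m 0 1 m = 0 <-> forall t, R (R t) = 0.
Proof.
rewrite -gcomm_eq0 /stem; set C := gcomm _ _ _ _.
have [m3 [hm3 e3]] := phi_surj gcomm_CoDer.
have ex : exists m', [set m' | Mcomp (0 + 0) 2 m' /\ phi V (0 + 0) 2 m' = C] m'.
  by exists m3.
have [hi pi] := xgetPex (fun _ : seq V => 0 : V) ex.
split=> [/eqP|C0].
  rewrite scaler_eq0 => /orP[/eqP s0|/eqP i0].
    have := sgn_sqr K (1 + dot (e1 *+ 1) (e1 *+ 1 + 0)).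
    by rewrite s0 mul0r => /esym/eqP; rewrite oner_eq0.
  by rewrite -pi -[xget _ _]/(phi_inv (0 + 0) 2 C) i0 phi0.
have e0 : phi_inv (0 + 0) 2 C = 0.
  by apply: (phi_inj hi (Mcomp0 _ _)); rewrite pi C0 phi0.
by rewrite [phi_inv _ _ _]e0 scaler0.
Qed.
End Binary.

(** The bracket sums over the homogeneous components of x, of which there is just
one here; the element 0 has none. *)
Lemma stem_bracket_homog w (x : MrG V) : gcomp w x -> x != 0 ->
  stem_bracket V x x = stem_hom w w x x.
Proof.
move=> hx x0; rewrite /stem_bracket.
have hdec b : dec x b = if b == w then x else 0 by apply: dec_hom.
have -> : finsupp (dec x) = [fset w]%fset.
  apply/fsetP => b; rewrite mem_finsupp hdec in_fset1.
  by case: (b =P w) => _ //; apply/negbTE/negPn/eqP.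
have sum1 (F : 'rV[int]_(n.+1 + 1) -> MrG V) : \sum_(b <- [fset w]%fset) F b = F w.
  exact: big_seq_fset1.
by rewrite !sum1 hdec eqxx.
Qed.

Lemma mval_zero : mval (0 : Mr V) = 0.
Proof. by rewrite -[mval]/(val : Mr V -> _) linear0. Qed.

Lemma stem_bracket_eq0 (charK : [pchar K] =i pred0) (x : MrG V) : Mcomp 0 1 (mval x) ->
  stem_bracket V x x = 0 <-> stem 0 1 (mval x) 0 1 (mval x) = 0.
Proof.
move=> hx; have [->|x0] := eqVneq x 0.
  split=> _.
    rewrite mval_zero; apply/(stem_eq0 (Mcomp0 _ _) charK) => t.
    by rewrite phi0.
  rewrite /stem_bracket (_ : finsupp _ = fset0) ?big_seq_fset0 //.
  by apply/fsetP => b; rewrite mem_finsupp (dec_hom b (gcomp0 _ 0)) if_same eqxx.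
rewrite (stem_bracket_homog (Mr_comp_mdeg hx) x0) /stem_hom.
have -> : mdeg2 (mdeg (0 : 'rV_n.+1) 1) = 1%N by rewrite /mdeg2 /mdeg row_mxKr mxE.
have -> : mdeg1 (mdeg (0 : 'rV_n.+1) 1) = 0 by rewrite /mdeg1 /mdeg row_mxKl.
split=> [/(congr1 mval)|h]; first by rewrite mval_zero.
by apply/val_inj; rewrite [val 0]mval_zero.
Qed.
End Phi.

(** * Loday structures, codifferentials and canonical elements *)

Lemma dot_mdeg n (A B : 'rV[int]_n.+1) a b : dot (mdeg A a) (mdeg B b) = dot A B + a * b.
Proof.
rewrite /dot big_split_ord big_ord1 /mdeg !row_mxEr !mxE; congr (_ + _).
by apply: eq_bigr => i _; rewrite !row_mxEl.
Qed.

Theorem theorem4 (K : fieldType) (charK : [pchar K] =i pred0) (n : nat)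
    (V : gradedSpace K n.+1) :
  set_bij (Lod V) (CoDiff (desusp V) (e1 n) 2) (phi V 0 1) /\
  Lod V = mval @` canonical_elt (stem_bracket V) (mdeg 0 1).
Proof.
have E : 0 + e1 n *+ 1 = e1 n by rewrite add0r.
split; first split.
- move=> m hm; split; last exact/(loday_codifferential hm.1 charK).
  by have := phi_coder hm.1; rewrite E.
- by move=> m m' /set_mem hm /set_mem hm'; apply: phi_inj; [apply: hm.1 | apply: hm'.1].
- move=> R [cR RR]; rewrite -E in cR; have [m [hm e]] := phi_surj cR.
  by exists m => //; apply/(loday_codifferential hm charK) => t; rewrite e.
have Mdeg (x : MrG V) : gcomp (mdeg 0 1) x -> Mcomp 0 1 (mval x).
  by rewrite /= /Mr_comp /mdeg1 /mdeg2 /mdeg row_mxKl row_mxKr mxE.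
have Lod0 (x : MrG V) : Mcomp 0 1 (mval x) -> stem_bracket V x x = 0 <-> Lod V (mval x).
  move=> hx; apply: iff_trans (iff_sym (loday_codifferential hx charK)).
  exact: iff_trans (stem_bracket_eq0 charK hx) (stem_eq0 hx charK).
apply/seteqP; split=> [m hm|_ [x [hx _ /Lod0 h] <-]]; last exact/h/Mdeg.
have mM : m \in spanp (@Mr_set _ _ V) by apply/asboolP/span_gen; exists 0, 1; case: hm.
exists (MkMr mM) => //; split.
- by apply: Mr_comp_mdeg; case: hm.
- by rewrite dot_mdeg dot0l.
- by apply/Lod0 => //; case: hm.
Qed.
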